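(* Let $R$ be an $h$-local Prüfer domain. A torsion-free $R$-module $M$ is isomorphic to a direct sum of ideals of $R$ if it is the union of a countable ascending chain $$0 = M_0 \leq M_1 \leq \dots \leq M_n \leq \dots \quad (n<\omega)$$ of submodules, such that the following properties are satisfied for every $n<\omega$: (i) $M_n$ is isomorphic to a direct sum of ideals of $R$, (ii) $M_{n+1}/M_n$ has a $G(\aleph_0)$-family $\mathcal{C}_n$ of pure submodules, and (iii) $M_n$ is pure in $M$.
   Context: A Prüfer domain is an integral domain in which every finitely generated ideal is projective. An integral domain $R$ is $h$-local if (i) every nonzero prime ideal of $R$ is contained in exactly one maximal ideal, and (ii) every nonzero element of $R$ is contained in only finitely many maximal ideals. A submodule $N$ of an $R$-module $M$ is pure in $M$ if every finite system of equations $\sum_{j=1}^m r_{ij}x_j = a_i \in N$ ($i=1,\dots,n$), with $r_{ij}\in R$, is solvable in $N$ whenever it is solvable in $M$. Direct sums of ideals are direct sums of ideals of $R$ regarded as $R$-modules. A $G(\aleph_0)$-family of an $R$-module $X$ is a family $\mathcal{B}$ of submodules of $X$ such that: (i) $0, X\in\mathcal{B}$; (ii) $\mathcal{B}$ is closed under unions of ascending chains of arbitrary lengths; (iii) for every $A_0\in\mathcal{B}$ and every countable set $H\subseteq X$, there exists $A\in\mathcal{B}$ containing $A_0$ and $H$ such that $A/A_0$ is countably generated. A $G(\aleph_0)$-family of pure submodules is one all of whose members are pure in $X$. *)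

(* Defs.v *)
From HB Require Import structures.
From mathcomp Require Import all_boot all_order all_algebra.
From mathcomp Require Import ring_quotient.
From mathcomp Require Import boolp wochoice classical_sets functions cardinality.

Set Implicit Arguments.
Unset Strict Implicit.
Unset Printing Implicit Defensive.

Import GRing.Theory.

Local Open Scope ring_scope.
Local Open Scope classical_set_scope.
Local Open Scope quotient_scope.

(* Throughout, a submodule of V is an element of the library's
   [submodClosed V]: a boolean predicate on V closed under 0, + and scaling.
   As every proposition is decidable here (boolp), these are all the
   submodules of V. *)

Lemma submod_ext (R : pzRingType) (V : lmodType R) (N N' : submodClosed V) :
  N =i N' -> N = N'.
Proof.
move=> eqN; have eqs : N = N' :> {pred V} by apply: funext => x; exact: eqN.
case: N N' eqs {eqN} => [S [[D] [Z]]] [S' [[D'] [Z']]] /= eqs.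
case: _ / eqs in D' Z' *.
by rewrite (Prop_irrelevance D D') (Prop_irrelevance Z Z').
Qed.

Section Submodules.
Variables (R : pzRingType) (V : lmodType R).

Definition mk_submod (S : {pred V}) (clS : submod_closed S) : submodClosed V :=
  HB.pack_for (submodClosed V) S (GRing.isSubmodClosed.Build R V S clS).

Lemma zero_submod_closed : submod_closed (pred1 (0 : V)).
Proof.
split; rewrite ?inE // => a x y; rewrite !inE => /eqP-> /eqP->.
by rewrite scaler0 addr0.
Qed.

Lemma full_submod_closed : submod_closed (predT : pred V).
Proof. by []. Qed.

Definition zero_submod : submodClosed V := mk_submod zero_submod_closed.
Definition full_submod : submodClosed V := mk_submod full_submod_closed.

End Submodules.
Arguments zero_submod {R} V.
Arguments full_submod {R} V.

Section SubmoduleAsModule.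
Variables (R : pzRingType) (V : lmodType R) (N : submodClosed V).

Definition submod_type : Type := {x : V | x \in N}.

HB.instance Definition _ := SubChoice.on submod_type.
HB.instance Definition _ := [SubChoice_isSubLmodule of submod_type by <:].

Definition submod_mod : lmodType R := submod_type : lmodType R.

End SubmoduleAsModule.

Section QuotientModule.
Variables (R : pzRingType) (V : lmodType R) (N : submodClosed V).

Lemma submod_zmod_closed : zmod_closed N.
Proof.
split=> [|x y xN yN]; first exact: rpred0.
by rewrite -scaleN1r rpredD ?rpredZ.
Qed.

Definition zmod_of_submod : zmodClosed V :=
  HB.pack_for (zmodClosed V) (N : {pred V})
    (GRing.isZmodClosed.Build V (N : {pred V}) submod_zmod_closed).

Definition quot_type : Type := Quotient.quot zmod_of_submod.

HB.instance Definition _ := GRing.Zmodule.on quot_type.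

Local Notation Q := (Quotient.quot zmod_of_submod).

Definition quot_scale (a : R) (x : quot_type) : quot_type :=
  \pi_Q (a *: repr (x : Q)).

Lemma pi_scale a (x : V) : quot_scale a (\pi_Q x) = \pi_Q (a *: x).
Proof.
apply/eqP; rewrite -Quotient.idealrBE -scalerBr; apply: (@rpredZ R V N).
by rewrite -[_ \in _]/(_ \in zmod_of_submod) Quotient.idealrBE reprK.
Qed.

Fact quot_scalerA a b x : quot_scale a (quot_scale b x) = quot_scale (a * b) x.
Proof. by rewrite -[x](@reprK _ Q) !pi_scale scalerA. Qed.

Fact quot_scale1r : left_id 1 quot_scale.
Proof. by move=> x; rewrite -[x](@reprK _ Q) !pi_scale scale1r. Qed.

Fact quot_scalerDr : right_distributive quot_scale +%R.
Proof.
move=> a x y; rewrite -[x](@reprK _ Q) -[y](@reprK _ Q).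
by rewrite -raddfD !pi_scale -raddfD scalerDr.
Qed.

Fact quot_scalerDl x : {morph quot_scale^~ x : a b / a + b}.
Proof.
by move=> a b; rewrite -[x](@reprK _ Q) !pi_scale -raddfD scalerDl.
Qed.

HB.instance Definition _ := GRing.Zmodule_isLmodule.Build R quot_type
  quot_scalerA quot_scale1r quot_scalerDr quot_scalerDl.

Definition quot_mod : lmodType R := quot_type : lmodType R.

End QuotientModule.

Section Subquotient.
Variables (R : pzRingType) (V : lmodType R) (A N : submodClosed V).

Lemma submod_in_closed :
  submod_closed [pred x : submod_mod A | val x \in N].
Proof.
split=> [|a x y]; rewrite !inE; first by rewrite raddf0 rpred0.
by move=> xN yN; rewrite linearP rpredD ?rpredZ.
Qed.

Definition submod_in : submodClosed (submod_mod A) :=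
  mk_submod submod_in_closed.

(* A / N; only used when N is contained in A. *)
Definition subquot_mod : lmodType R := quot_mod submod_in.

End Subquotient.

Section ModuleNotions.
Variable R : pzRingType.

Definition isomorphic (U V : lmodType R) : Prop :=
  exists f : {linear U -> V}, bijective f.

Definition projective (P : lmodType R) : Prop :=
  forall (A B : lmodType R) (g : {linear A -> B}) (f : {linear P -> B}),
    (forall b, exists a, g a = b) ->
    exists h : {linear P -> A}, forall x, g (h x) = f x.

Definition generates (X : lmodType R) (S : set X) : Prop :=
  forall N : submodClosed X, (forall x, S x -> x \in N) -> forall x, x \in N.

Definition finitely_generated (X : lmodType R) : Prop :=
  exists S : set X, finite_set S /\ generates S.

Definition countably_generated (X : lmodType R) : Prop :=
  exists S : set X, countable S /\ generates S.

Definition torsion_free (X : lmodType R) : Prop :=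
  forall (a : R) (x : X), a *: x = 0 -> a = 0 \/ x = 0.

Definition pure (X : lmodType R) (N : submodClosed X) : Prop :=
  forall (n m : nat) (r : 'M[R]_(n, m)) (a : 'I_n -> X),
    (forall i, a i \in N) ->
    (exists x : 'I_m -> X, forall i, \sum_j r i j *: x j = a i) ->
    exists2 x : 'I_m -> X, (forall j, x j \in N) &
      forall i, \sum_j r i j *: x j = a i.

(* Ascending chains of arbitrary length are families indexed by an arbitrary
   well-ordered set.  The index set may be empty, but then no submodule U
   satisfies the union condition. *)
Record G_family (X : lmodType R) (B : set (submodClosed X)) : Prop := {
  G_family0 : B (zero_submod X);
  G_familyT : B (full_submod X);
  G_family_chain : forall (I : Type) (le : rel I) (A : I -> submodClosed X)
      (U : submodClosed X),
    well_order le ->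
    (forall i, B (A i)) ->
    (forall i j, le i j -> {subset A i <= A j}) ->
    (forall x, x \in U <-> exists i, x \in A i) ->
    B U;
  G_family_countable : forall (A0 : submodClosed X) (H : set X),
    B A0 -> countable H ->
    exists A : submodClosed X,
      [/\ B A, {subset A0 <= A}, (forall x, H x -> x \in A) &
          countably_generated (subquot_mod A A0)] }.

Definition G_family_pure (X : lmodType R) (B : set (submodClosed X)) : Prop :=
  G_family B /\ forall A, B A -> pure A.

End ModuleNotions.

Section Rings.
Variable R : idomainType.

Definition ideal : Type := submodClosed R^o.

Definition prime_ideal (P : ideal) : Prop :=
  1 \notin P /\ prime_idealr_closed (P : {pred R}).

Definition maximal_ideal (m : ideal) : Prop :=
  1 \notin m /\
  forall J : ideal, 1 \notin J -> {subset m <= J} -> J = m.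

Definition pruefer : Prop :=
  forall J : ideal, finitely_generated (submod_mod J) ->
    projective (submod_mod J).

Definition h_local : Prop :=
  (forall P : ideal, prime_ideal P -> P <> zero_submod R^o ->
     exists! m : ideal, maximal_ideal m /\ {subset P <= m}) /\
  (forall a : R, a != 0 ->
     finite_set [set m : ideal | maximal_ideal m /\ a \in m]).

Section DirectSum.
Variables (I : Type) (J : I -> ideal).

Definition dsum_pred : {pred (I -> R^o)} :=
  fun f => `[< (forall i, f i \in J i) /\ finite_set [set i | f i != 0] >].

Lemma dsum_closed : submod_closed dsum_pred.
Proof.
split=> [|a f g /asboolP[fJ ff] /asboolP[gJ fg]]; apply/asboolP; split.
- by move=> i; rewrite rpred0.
- rewrite (_ : [set _ | _] = set0) //.
  by apply/seteqP; split=> i //=; rewrite eqxx.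
- by move=> i; rewrite rpredD ?rpredZ.
- apply: (@sub_finite_set _ _ ([set i | f i != 0] `|` [set i | g i != 0])).
    move=> i /=; case: (eqVneq (f i) 0) => [fi0|]; last by left.
    rewrite -[(a *: f + g) i]/(a *: f i + g i) fi0 scaler0 add0r.
    by right.
  by rewrite finite_setU.
Qed.

(* The direct sum of the J i, as the finitely supported families in the
   product module I -> R. *)
Definition dsum_ideals : lmodType R := submod_mod (mk_submod dsum_closed).

End DirectSum.

Definition iso_dsum_ideals (X : lmodType R) : Prop :=
  exists (I : Type) (J : I -> ideal), isomorphic X (dsum_ideals J).

End Rings.

(* Main.v *)
Require Import Defs.
From HB Require Import structures.
From mathcomp Require Import all_boot all_order all_algebra.
From mathcomp Require Import ring_quotient.
From mathcomp Require Import boolp wochoice classical_sets functions cardinality.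

(** Over an h-local Pruefer domain the pure closure [line x] of an element x of
    a direct sum of ideals J_i is a summand: the r for which some homomorphism
    into [line x] sends x to r x form an ideal, and at a maximal ideal m this
    ideal is not inside m, because the localised fractional ideals x_i^-1 J_i
    are linearly ordered and, R being h-local, (J : J_i) commutes with
    localisation, so that projecting to a minimal coordinate works.

    Call a pure A <= M good if A meets each M_n in a partial sum of its
    decomposition and the image of A in each M_(n+1) / M_n lies in C_n.
    Closing off countably often embeds a good A and an element x in a good B
    with B / A of countable rank. For good A every A + M_n is pure in M and
    equals A plus a partial sum of M_n, so adjoining one element of B at a time
    splits off pure rank-one submodules, and B is the direct sum of A and
    countably many of these. By Zorn's lemma M is a direct sum of pure rank-one
    submodules, each of which embeds in an ideal through some coordinate of
    some M_n. Purity is used only in the form: a x in A and a <> 0 imply x in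
    A. *)

Set Implicit Arguments.
Unset Strict Implicit.
Unset Printing Implicit Defensive.

Import GRing.Theory.

Local Open Scope ring_scope.
Local Open Scope classical_set_scope.

(** * Submodules handled as sets *)

Section SetSubmodules.
Variables (R : pzRingType) (V : lmodType R).
Implicit Types (N : set V) (F : set (set V)).

(** Sets instead of [submodClosed] structures: intersections, unions of chains and Zorn's lemma for
    sets of sets then apply directly. *)
Definition submodule N := N 0 /\ forall a x y, N x -> N y -> N (a *: x + y).

Lemma submodule0 N : submodule N -> N 0. Proof. by case. Qed.

Lemma submoduleZ N a x : submodule N -> N x -> N (a *: x).
Proof. by move=> [N0 NP] Nx; rewrite -[a *: x]addr0; apply: NP. Qed.

Lemma submoduleD N x y : submodule N -> N x -> N y -> N (x + y).
Proof. by move=> [N0 NP] Nx Ny; rewrite -[x]scale1r; apply: NP. Qed.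

Lemma submoduleN N x : submodule N -> N x -> N (- x).
Proof. by move=> sN Nx; rewrite -scaleN1r; apply: submoduleZ. Qed.

Lemma submoduleB N x y : submodule N -> N x -> N y -> N (x - y).
Proof. by move=> sN Nx Ny; apply: submoduleD => //; apply: submoduleN. Qed.

Lemma submodule_submodClosed (N : submodClosed V) : submodule [set` N].
Proof.
by split=> [|a x y] /=; [exact: rpred0 | move=> Nx Ny; rewrite rpredD ?rpredZ].
Qed.

Lemma asbool_submod_closed N : submodule N -> submod_closed [pred x | `[< N x >]].
Proof.
move=> [N0 NP]; split=> [|a x y]; first exact/asboolP.
by move=> /asboolP Nx /asboolP Ny; apply/asboolP/NP.
Qed.

Definition submod_of N (sN : submodule N) : submodClosed V :=
  mk_submod (asbool_submod_closed sN).

Lemma submod_ofE N (sN : submodule N) x : (x \in submod_of sN) <-> N x.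
Proof. by split=> /asboolP. Qed.

Lemma submodule_bigcup F : F !=set0 -> total_on F subset ->
  (forall N, F N -> submodule N) -> submodule (\bigcup_(N in F) N).
Proof.
move=> [N0 FN0] Ft Fs; split; first by exists N0 => //; exact: submodule0 (Fs _ _).
move=> a x y [N FN Nx] [N' FN' Ny].
by have [s|s] := Ft _ _ FN FN';
  [exists N' | exists N] => //; apply: (Fs _ _).2 => //; exact: s.
Qed.

Lemma submoduleI N N' : submodule N -> submodule N' -> submodule (N `&` N').
Proof.
move=> [N0 NP] [N'0 N'P]; split=> // a x y [Nx N'x] [Ny N'y].
by split; [exact: NP | exact: N'P].
Qed.

Definition addm N N' : set V := [set z | exists x y, [/\ N x, N' y & z = x + y]].

Lemma submodule_addm N N' : submodule N -> submodule N' -> submodule (addm N N').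
Proof.
move=> sN sN'; split; first by exists 0, 0; split; rewrite ?addr0 //; exact: submodule0.
move=> a _ _ [x [y [Nx Ny ->]]] [x' [y' [Nx' Ny' ->]]].
exists (a *: x + x'), (a *: y + y'); split; [exact: sN.2|exact: sN'.2|].
by rewrite scalerDr addrACA.
Qed.

Lemma addm_subl N N' : submodule N' -> N `<=` addm N N'.
Proof. by move=> sN' x Nx; exists x, 0; split; rewrite ?addr0 //; exact: submodule0. Qed.

Lemma addm_subr N N' : submodule N -> N' `<=` addm N N'.
Proof. by move=> sN x Nx; exists 0, x; split; rewrite ?add0r //; exact: submodule0. Qed.

Lemma addm_sub N N' P : submodule P -> N `<=` P -> N' `<=` P -> addm N N' `<=` P.
Proof. by move=> sP NP N'P _ [x [y [/NP Px /N'P Py ->]]]; exact: submoduleD. Qed.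

Lemma addmS N1 N2 N1' N2' :
  N1 `<=` N2 -> N1' `<=` N2' -> addm N1 N1' `<=` addm N2 N2'.
Proof. by move=> s s' _ [x [y [/s ? /s' ? ->]]]; exists x, y. Qed.

End SetSubmodules.

(** * Ideals of an h-local Pruefer domain and their localisations *)

Section RingTheory.
Variable R : idomainType.

Definition is_ideal (J : set R) := @submodule R R^o J.

Definition ideal_of (J : set R) (iJ : is_ideal J) : ideal R := submod_of iJ.

Lemma ideal_ofE (J : set R) (iJ : is_ideal J) (x : R) : x \in ideal_of iJ <-> J x.
Proof. by split=> /asboolP. Qed.

Lemma ideal_mull (J : set R) (a x : R) : is_ideal J -> J x -> J (a * x).
Proof. exact: (@submoduleZ R R^o). Qed.

Lemma ideal_add (J : set R) (x y : R) : is_ideal J -> J x -> J y -> J (x + y).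
Proof. exact: (@submoduleD R R^o). Qed.

Lemma ideal_mulr (J : set R) (a x : R) : is_ideal J -> J x -> J (x * a).
Proof. by rewrite mulrC; exact: ideal_mull. Qed.

Definition principal (c : R) : set R := [set x | exists r, x = r * c].

Lemma principal_ideal c : is_ideal (principal c).
Proof.
split=> [|a _ _ [r ->] [r' ->]]; first by exists 0; rewrite mul0r.
by exists (a * r + r'); rewrite mulrDl -mulrA.
Qed.

Lemma exists_maximal_avoiding (S I : set R) : is_ideal I -> I `&` S = set0 ->
  exists P : set R, [/\ is_ideal P, I `<=` P, P `&` S = set0 &
    forall J, is_ideal J -> P `<=` J -> J `&` S = set0 -> J = P].
Proof.
move=> iI IS.
pose Q (P : set R) := P = set0 \/ [/\ is_ideal P, I `<=` P & P `&` S = set0].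
have [F FQ Ft|P [QP Pmax]] := @Zorn_bigcup R Q.
  have [[P [FP P0]]|noP] := pselect (exists P, F P /\ P <> set0); last first.
    left; apply/seteqP; split=> // x [P FP Px]; apply: noP; exists P; split => //.
    by move=> P0; move: Px; rewrite P0.
  right; pose F' := F `&` [set P | P <> set0].
  have -> : \bigcup_(X in F) X = \bigcup_(X in F') X.
    apply/seteqP; split=> x [X FX Xx]; exists X => //; last by case: FX.
    by split=> // X0; move: Xx; rewrite X0.
  have F'Q X : F' X -> [/\ is_ideal X, I `<=` X & X `&` S = set0].
    by case=> /FQ[].
  split.
  - apply: (@submodule_bigcup R R^o); first by exists P.
    + by move=> X Y [FX _] [FY _]; exact: Ft.
    + by move=> X /F'Q[].
  - by move=> x Ix; exists P => //; have [_ + _] := F'Q P (conj FP P0); apply.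
  - apply/seteqP; split=> // x [[X /F'Q[_ _ XS] Xx] Sx].
    by rewrite -XS.
have QI : Q I by right; split.
have nP0 : P <> set0.
  move=> P0; apply: (Pmax I) => //; rewrite P0; split=> // I0.
  by have := I0 0 (submodule0 iI).
case: QP => // -[iP IP PS]; exists P; split=> // J iJ PJ JS.
apply: contrapT => nJP; apply: (Pmax J); last by right; split=> // x /IP /PJ.
by split=> // JP; apply: nJP; apply/seteqP.
Qed.

Lemma maximal_comax (m : ideal R) a : maximal_ideal m -> a \notin m ->
  exists r p, p \in m /\ 1 = r * a + p.
Proof.
move=> [m1 mM] am; pose J : set R := [set x | exists r p, p \in m /\ x = r * a + p].
have iJ : is_ideal J.
  split; first by exists 0, 0; rewrite rpred0 mul0r addr0.
  move=> b _ _ [r [p [pm ->]]] [r' [p' [pm' ->]]].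
  exists (b * r + r'), (b * p + p'); split; first by rewrite rpredD ?(rpredZ b).
  by rewrite [b *: _]mulrDr mulrDl mulrA addrACA.
apply: contrapT => J1.
have eJ : ideal_of iJ = m.
  apply: mM => [|x xm]; first by apply/negP => /ideal_ofE.
  by apply/ideal_ofE; exists 0, x; rewrite mul0r add0r.
move/negP: am; apply; rewrite -eJ; apply/ideal_ofE.
by exists 1, 0; rewrite rpred0 mul1r addr0.
Qed.

Lemma maximal_mul (m : ideal R) a b : maximal_ideal m ->
  a \notin m -> b \notin m -> a * b \notin m.
Proof.
move=> mm /(maximal_comax mm)[r [p [pm e]]] bm; apply/negP => abm.
have : b = r * (a * b) + b * p by rewrite mulrA (mulrC b) -mulrDl -e mul1r.
by move=> eb; move: bm; rewrite eb rpredD ?(rpredZ r) ?(rpredZ b).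
Qed.

(** An ideal without 1 lies in a maximal ideal. This is the local-global principle of the proof:
    membership of 1 is tested at one maximal ideal at a time. *)
Lemma ideal_full (W : set R) : is_ideal W ->
  (forall m : ideal R, maximal_ideal m -> exists2 s, W s & s \notin m) -> W 1.
Proof.
move=> iW Wm; apply: contrapT => W1.
have WS : W `&` [set 1] = set0 by apply/seteqP; split=> // x [Wx /= ex]; apply: W1; rewrite -ex.
have [P [iP WP PS Pmax]] := exists_maximal_avoiding iW WS.
have mP : maximal_ideal (ideal_of iP).
  split=> [|J J1 PJ].
    by apply/negP => /ideal_ofE P1; have : (P `&` [set 1]) 1 by []; rewrite PS.
  have eJ : [set` J] = P :> set R.
    apply: Pmax; first exact: (@submodule_submodClosed R R^o).
      by move=> x Px; apply: PJ; apply/ideal_ofE.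
    by apply/seteqP; split=> // x [Jx /= ex]; move: Jx J1; rewrite /= ex => ->.
  by apply: submod_ext => x; apply/idP/idP=> [xJ|/PJ//]; apply/ideal_ofE; rewrite -eJ.
have [s Ws /negP] := Wm _ mP; apply; apply/(ideal_ofE iP s).2; exact: WP.
Qed.

(* At distinct maximal ideals the localisations of an h-local domain are
   independent: inverting both complements makes every c <> 0 a unit, since a
   prime containing c and missing both complements would lie in m and m'. *)
Lemma h_local_independent (m m' : ideal R) c : h_local R ->
  maximal_ideal m -> maximal_ideal m' -> m <> m' -> c != 0 ->
  exists s t, [/\ s \notin m, t \notin m' & principal c (s * t)].
Proof.
move=> [hP _] mm mm' neq c0; apply: contrapT => nex.
pose S : set R := [set x | exists s t, [/\ s \notin m, t \notin m' & x = s * t]].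
have cS : principal c `&` S = set0.
  by apply/seteqP; split=> // x [cx [s [t [sm tm ex]]]]; apply: nex; exists s, t; rewrite -ex.
have [P [iP cP PS Pmax]] := exists_maximal_avoiding (principal_ideal c) cS.
have addS a : ~ P a -> exists r p, P p /\ S (r * a + p).
  move=> Pa; pose J : set R := addm (V := R^o) (principal a) P.
  have iJ : is_ideal J by apply: submodule_addm => //; exact: principal_ideal.
  apply: contrapT => nS; apply: Pa.
  rewrite -(Pmax J) //.
  - by apply: addm_subl => //; exists 1; rewrite mul1r.
  - exact: (@addm_subr R R^o _ _ (principal_ideal a)).
  - apply/seteqP; split=> // x [[_ [p [[r ->] Pp ex]]] Sx]; apply: nS.
    by exists r, p; split => //; rewrite -[_ + _]ex.
have SM x y : S x -> S y -> S (x * y).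
  move=> [s [t [sm tm ->]]] [s' [t' [sm' tm' ->]]].
  by exists (s * s'), (t * t'); split; rewrite ?maximal_mul // mulrACA.
have primeP : prime_ideal (ideal_of iP).
  split.
    apply/negP => /ideal_ofE P1; have : (P `&` S) 1; last by rewrite PS.
    by split=> //; exists 1, 1; rewrite mulr1; split=> //; [case: mm|case: mm'].
  move=> u v /ideal_ofE uv; apply: contrapT => /negP.
  rewrite negb_or => /andP[/negP uP /negP vP].
  have [r [p [Pp Su]]] := addS u (fun h => uP ((ideal_ofE iP u).2 h)).
  have [r' [p' [Pp' Sv]]] := addS v (fun h => vP ((ideal_ofE iP v).2 h)).
  have : (P `&` S) ((r * u + p) * (r' * v + p')); last by rewrite PS.
  split; last exact: SM.
  rewrite mulrDr; apply: ideal_add => //; last exact: ideal_mull.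
  rewrite mulrDl mulrACA; apply: ideal_add => //; [exact: ideal_mull|exact: ideal_mulr].
have Pm x : P x -> x \in m /\ x \in m'.
  move=> Px; split; apply: contrapT => /negP xm; (have : (P `&` S) x; last by rewrite PS); split=> //.
    by exists x, 1; rewrite mulr1; split=> //; case: mm'.
  by exists 1, x; rewrite mul1r; split=> //; case: mm.
have nz : ideal_of iP <> zero_submod R^o.
  move=> eP; have : c \in ideal_of iP by apply/ideal_ofE/cP; exists 1; rewrite mul1r.
  by rewrite eP inE; exact/negP.
have [m0 [_ um0]] := hP _ primeP nz.
by apply: neq; rewrite -(um0 m) ?(um0 m') //; split=> // x /ideal_ofE /Pm[].
Qed.

(** Inclusion of the localisations at [m] with denominators cleared. Here [s] may depend on [y];
    [loc_le_uniform] removes this dependence. *)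
Definition loc_le (m : ideal R) (I I' : set R) :=
  forall y, I y -> exists2 s, s \notin m & I' (s * y).


(** Only finitely many maximal ideals contain [c], so the elements that [h_local_independent]
    supplies for each of them multiply to a single [s]. *)
Lemma h_local_clear (m : ideal R) c : h_local R -> maximal_ideal m -> c != 0 ->
  exists2 s, s \notin m & forall m' : ideal R, maximal_ideal m' -> c \in m' ->
    m <> m' -> exists2 t, t \notin m' & principal c (s * t).
Proof.
move=> hl mm c0; have /(@finite_seqP {classic (ideal R)})[q eq] := hl.2 _ c0.
suff [s sm sP] : exists2 s, s \notin m & forall m' : ideal R, maximal_ideal m' ->
    (m' : {classic (ideal R)}) \in q -> m <> m' ->
    exists2 t, t \notin m' & principal c (s * t).
  exists s => // m' mm' cm'; apply: sP => //.
  by have : [set` q] m' by rewrite -eq.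
elim: q {eq} => [|m1 q [s sm sP]]; first by exists 1 => //; case: mm.
have [[mm1 nm1]|nmm1] := pselect (maximal_ideal (m1 : ideal R) /\ m <> m1); last first.
  exists s => // m' mm'; rewrite in_cons => /orP[/eqP e|]; last exact: sP.
  by move=> nm; case: nmm1; rewrite -e.
have [s' [t [s'm tm cst]]] := h_local_independent hl mm mm1 nm1 c0.
exists (s' * s); first exact: maximal_mul.
move=> m' mm'; rewrite in_cons => /orP[/eqP -> _|m'q /(sP _ mm' m'q)[t' tm' ct']].
  exists t => //; rewrite mulrAC; exact: ideal_mulr (principal_ideal c) cst.
exists t' => //; rewrite -mulrA; exact: ideal_mull (principal_ideal c) ct'.
Qed.

(* (I' : I)_m = (I'_m : I_m) *)
Lemma loc_le_uniform (m : ideal R) (I I' : set R) c : h_local R ->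
  maximal_ideal m -> is_ideal I' -> c != 0 -> I' c -> loc_le m I I' ->
  exists2 s, s \notin m & forall y, I y -> I' (s * y).
Proof.
move=> hl mm iI' c0 I'c mII'; have [s sm sP] := h_local_clear hl mm c0.
have cI' x : principal c x -> I' x by move=> [r ->]; exact: ideal_mull.
exists s => // y Iy.
(* [W] escapes every maximal ideal: by [c] itself where [c] is not a member, by the hypothesis
   [mII'] at [m], and by the choice of [s] at the remaining ones. *)
pose W : set R := [set r | I' (r * (s * y))].
have iW : is_ideal W.
  split; first by rewrite /W /= mul0r; exact: submodule0 iI'.
  move=> a x z; rewrite /W /= => Wx Wz.
  by rewrite mulrDl -mulrA; apply: ideal_add => //; exact: ideal_mull.
suff : W 1 by rewrite /W /= mul1r.
apply: ideal_full => // m' mm'.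
have [cm'|cm'] := boolP (c \in m'); last first.
  by exists c => //; exact: ideal_mulr.
have [<-|nm] := pselect (m = m').
  have [t tm I't] := mII' _ Iy; exists t => //.
  by rewrite /W /= mulrCA; exact: ideal_mull.
have [t tm' cst] := sP _ mm' cm' nm; exists t => //.
by rewrite /W /= mulrA (mulrC t); apply: ideal_mulr => //; exact: cI'.
Qed.

Definition mk_linear (U V : lmodType R) (f : U -> V) (lf : linear f) :
  {linear U -> V} := HB.pack f (GRing.isLinear.Build R U V *:%R f lf).

(** The localisation at [m] is a valuation ring. For [a] nonzero, projectivity gives a section [h]
    of the map from R^2 onto the ideal generated by [a] and [b]. From [a *: h be = b *: h al] it
    follows that the first coordinate of [h al] and the second of [h be] add up to 1, so one of them
    is outside [m] and serves as [s]. *)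
Lemma pruefer_valuation (m : ideal R) (a b : R) : pruefer R -> maximal_ideal m ->
  exists2 s, s \notin m & principal b (s * a) \/ principal a (s * b).
Proof.
move=> pR mm; have [->|a0] := eqVneq a 0.
  exists 1; first by case: mm.
  by left; exists 0; rewrite mul0r mulr0.
have iJ : is_ideal (addm (V := R^o) (principal a) (principal b)).
  by apply: submodule_addm; exact: principal_ideal.
pose J := ideal_of iJ; pose B := submod_mod J.
have Jab (x y : R) : x * a + y * b \in J.
  by apply/ideal_ofE; exists (x * a), (y * b); split=> //; [exists x|exists y].
have aJ : a \in J by rewrite -[a]addr0 -[a]mul1r -(mul0r b).
have bJ : b \in J by rewrite -[b]add0r -[b]mul1r -(mul0r a).
pose al : B := exist _ a aJ; pose be : B := exist _ b bJ.
pose g (p : (R^o * R^o)%type) : B := exist (fun x : R^o => x \in J) _ (Jab p.1 p.2).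
have lg : linear g.
  have e (k u v u' v' : R) :
    (k * u + u') * a + (k * v + v') * b = k * (u * a + v * b) + (u' * a + v' * b).
    by rewrite mulrDr !mulrDl !mulrA addrACA.
  by move=> k x y; apply: val_inj; exact: e.
have gsurj z : exists p, g p = z.
  have /ideal_ofE[_ [_ [[x ->] [y ->] ez]]] := valP z.
  by exists (x, y); apply: val_inj.
have fgJ : finitely_generated B.
  exists [set al; be]; split; first exact: finite_set2.
  move=> N NS z; have [[x y] <-] := gsurj z.
  have -> : g (x, y) = x *: al + y *: be by apply: val_inj.
  by rewrite rpredD ?rpredZ //; apply: NS; [left|right].
have lid : linear (@id B) by [].
have [h hP] := pR J fgJ _ _ (mk_linear lg) (mk_linear lid) gsurj.
have ha : (h al).1 * a + (h al).2 * b = a by have /(congr1 val) := hP al.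
have e : a *: h be = b *: h al.
  by rewrite -!linearZ; congr (h _); apply: val_inj; rewrite /= [LHS]mulrC.
have e1 : a * (h be).1 = b * (h al).1 by have /(congr1 fst) := e.
have e2 : a * (h be).2 = b * (h al).2 by have /(congr1 snd) := e.
have s1 : (h al).1 + (h be).2 = 1.
  by apply: (mulIf a0); rewrite mul1r mulrDl (mulrC (h be).2) e2 (mulrC b).
have [um|um] := boolP ((h al).1 \in m); last first.
  by exists ((h al).1) => //; right; exists (h be).1; rewrite mulrC -e1 mulrC.
have [wm|wm] := boolP ((h be).2 \in m); last first.
  by exists ((h be).2) => //; left; exists (h al).2; rewrite mulrC e2 mulrC.
by case: mm => /negP[]; rewrite -s1 rpredD.
Qed.

(** An element of [I] that no factor outside [m] brings into [I'] divides every element of [I'] up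
    to such a factor. *)
Lemma loc_le_total (m : ideal R) (I I' : set R) : pruefer R ->
  maximal_ideal m -> is_ideal I -> is_ideal I' -> loc_le m I I' \/ loc_le m I' I.
Proof.
move=> pR mm iI iI'; have [|] := pselect (loc_le m I I'); first by left.
move=> /existsNP[y /not_implyP[Iy nI']]; right=> y' Iy'.
have [s sm [|] [r e]] := pruefer_valuation y y' pR mm.
  by case: nI'; exists s => //; rewrite e; exact: ideal_mull.
by exists s => //; rewrite e; exact: ideal_mull.
Qed.

End RingTheory.

(** * Relatively divisible submodules and rank-one closures *)

Lemma idempotent_add_eq0 (V : zmodType) (x : V) : x = x + x -> x = 0.
Proof. by move=> e; apply: (addrI x); rewrite -e addr0. Qed.

Section PureSets.
Variables (R : idomainType) (M : lmodType R) (M_tf : torsion_free M).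
Implicit Types (A N H X : set M) (F : set (set M)).

Lemma tfI (a : R) (x y : M) : a != 0 -> a *: x = a *: y -> x = y.
Proof.
move=> a0 /eqP; rewrite -subr_eq0 -scalerBr => /eqP /M_tf[/eqP|/eqP].
  by rewrite (negPf a0).
by rewrite subr_eq0 => /eqP.
Qed.

Lemma tf0 (a : R) (x : M) : a != 0 -> a *: x = 0 -> x = 0.
Proof. by move=> a0 e; apply: (tfI a0); rewrite scaler0. Qed.

(** For a submodule [N] this says that the quotient by [N] is torsion-free. *)
Definition rd_pure N := forall a x, a != 0 -> N (a *: x) -> N x.

Lemma pure_rd_pure (N : submodClosed M) : pure N -> rd_pure [set` N].
Proof.
move=> pN a x a0 /= Nax.
have [|x' x'N ex'] := pN 1%N 1%N (const_mx a) (fun _ => a *: x) (fun _ => Nax).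
  by exists (fun _ => x) => i; rewrite big_ord1 mxE.
by have := ex' ord0; rewrite big_ord1 mxE => /(tfI a0) <-.
Qed.

Lemma rd_pure0 : rd_pure [set 0].
Proof. by move=> a x a0 /= /(tf0 a0). Qed.

Lemma submodule_set0 : submodule [set (0 : M)].
Proof. by split=> // a x y /= -> ->; rewrite scaler0 addr0. Qed.

Lemma rd_pure_bigcup F : (forall N, F N -> rd_pure N) -> rd_pure (\bigcup_(N in F) N).
Proof. by move=> Fp a x a0 [N FN Nx]; exists N => //; exact: Fp Nx. Qed.

(* [ext A h] is the pure closure of A + R h. *)
Definition ext A (h : M) : set M := [set y | exists a b, a != 0 /\ A (a *: y - b *: h)].

Definition line (x : M) : set M := [set y | exists a b, a != 0 /\ a *: y = b *: x].

Lemma line_ext x : line x = ext [set 0] x.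
Proof.
apply/seteqP; split=> y [a [b [a0 e]]]; exists a, b; split=> //=.
  by rewrite e subrr.
by apply/eqP; rewrite -subr_eq0; apply/eqP.
Qed.

Lemma submodule_ext A h : submodule A -> submodule (ext A h).
Proof.
move=> sA; split.
  by exists 1, 0; rewrite oner_neq0 scaler0 scale0r subr0; split=> //; exact: submodule0.
move=> k x y [a [b [a0 Ax]]] [a' [b' [a'0 Ay]]].
exists (a * a'), (k * a' * b + a * b'); split; first exact: mulf_neq0.
rewrite (_ : _ - _ = (k * a') *: (a *: x - b *: h) + a *: (a' *: y - b' *: h)).
  by apply: sA.2 => //; exact: submoduleZ.
rewrite !scalerBr !scalerDr !scalerDl opprD !scalerA addrACA.
by rewrite (mulrC (a * a') k) (mulrC a a') mulrA (mulrC a' a).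
Qed.

Lemma rd_pure_ext A h : rd_pure (ext A h).
Proof.
move=> k x k0 [a [b [a0 Ax]]]; exists (a * k), b; split; first exact: mulf_neq0.
by rewrite -scalerA.
Qed.

Lemma ext_sub A h : A `<=` ext A h.
Proof. by move=> x Ax; exists 1, 0; rewrite oner_neq0 scale1r scale0r subr0. Qed.

Lemma ext_mem A h : submodule A -> ext A h h.
Proof.
by move=> sA; exists 1, 1; rewrite oner_neq0 subrr; split=> //; exact: submodule0.
Qed.

Lemma ext_min A h N : submodule N -> rd_pure N -> A `<=` N -> N h -> ext A h `<=` N.
Proof.
move=> sN pN AN Nh y [a [b [a0 /AN Ny]]]; apply: (pN a) => //.
by rewrite -(subrK (b *: h) (a *: y)); apply: submoduleD => //; exact: submoduleZ.
Qed.

Lemma submodule_line x : submodule (line x).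
Proof. rewrite line_ext; exact: submodule_ext submodule_set0. Qed.

Lemma line_min x N : submodule N -> rd_pure N -> N x -> line x `<=` N.
Proof.
move=> sN pN Nx; rewrite line_ext; apply: ext_min => // y /= ->; exact: submodule0.
Qed.

Definition lin_on N (phi : M -> M) :=
  forall a x y, N x -> N y -> phi (a *: x + y) = a *: phi x + phi y.

Lemma lin_on0 N phi : submodule N -> lin_on N phi -> phi 0 = 0.
Proof.
move=> [N0 _] l; apply: idempotent_add_eq0.
by have := l 1 0 0 N0 N0; rewrite scale1r addr0 scale1r.
Qed.

Lemma lin_onZ N phi a x : submodule N -> lin_on N phi -> N x ->
  phi (a *: x) = a *: phi x.
Proof.
by move=> sN l Nx; rewrite -[a *: x]addr0 l ?(lin_on0 sN l) ?addr0 //; exact: submodule0.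
Qed.

Lemma lin_onB N phi x y : submodule N -> lin_on N phi -> N x -> N y ->
  phi (x - y) = phi x - phi y.
Proof. by move=> sN l Nx Ny; rewrite addrC -scaleN1r l // scaleN1r addrC. Qed.

Lemma lin_on_line N phi x y : submodule N -> lin_on N phi -> N x -> N y ->
  line x y -> phi x = x -> phi y = y.
Proof.
move=> sN l Nx Ny [a [b [a0 e]]] ex; apply: (tfI a0).
by rewrite -(lin_onZ a sN l Ny) e (lin_onZ b sN l Nx) ex.
Qed.

End PureSets.

(** * Splitting off the line of an element of a direct sum of ideals *)

Lemma seq_least (T : eqType) (le : T -> T -> Prop) (s : seq T) :
  {in s &, forall i j, le i j \/ le j i} ->
  {in s & &, forall i j k, le i j -> le j k -> le i k} ->
  s != [::] -> exists2 i, i \in s & {in s, forall j, le i j}.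
Proof.
elim: s => // i [|j s] IH tot tr _.
  by exists i; rewrite ?mem_head // => j; rewrite inE => /eqP ->; case: (tot i i); rewrite ?mem_head.
have sub z : z \in j :: s -> z \in [:: i, j & s] by move=> zs; rewrite in_cons zs orbT.
have [||//|k ks kmin] := IH.
- by move=> x y /sub xs /sub ys; exact: tot.
- by move=> x y z /sub xs /sub ys /sub zs; exact: tr.
have [ik|ki] := tot i k (mem_head _ _) (sub _ ks).
  exists i; first exact: mem_head.
  move=> z; rewrite in_cons => /orP[/eqP ->|zs].
    by case: (tot i i); rewrite ?mem_head.
  apply: (tr i k z) => //; [exact: mem_head|exact: sub|exact: sub|exact: kmin].
exists k; first exact: sub.
by move=> z; rewrite in_cons => /orP[/eqP -> //|zs]; exact: kmin.
Qed.

(* Coordinates identifying the submodule N with the direct sum of the J i. *)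
Record coords (R : idomainType) (M : lmodType R) (N : set M) (I : choiceType)
    (J : I -> ideal R) (co : M -> I -> R) : Prop := {
  coords_lin : forall a x y i, N x -> N y -> co (a *: x + y) i = a * co x i + co y i;
  coords_mem : forall x i, N x -> co x i \in J i;
  coords_fin : forall x, N x -> exists s : seq I, forall i, co x i != 0 -> i \in s;
  coords_sur : forall (g : I -> R) (s : seq I), (forall i, g i \in J i) ->
    (forall i, g i != 0 -> i \in s) -> exists2 x, N x & forall i, co x i = g i;
  coords_inj : forall x, N x -> (forall i, co x i = 0) -> x = 0 }.

Section Coords.
Variables (R : idomainType) (M : lmodType R) (M_tf : torsion_free M).
Variables (N : set M) (sN : submodule N) (I : choiceType) (J : I -> ideal R).
Variables (co : M -> I -> R) (coP : coords N J co).

Lemma coords0 i : co 0 i = 0.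
Proof.
have N0 := submodule0 sN; apply: idempotent_add_eq0.
by have := coords_lin coP 1 i N0 N0; rewrite scale1r addr0 mul1r.
Qed.

Lemma coordsZ a x i : N x -> co (a *: x) i = a * co x i.
Proof.
by move=> Nx; rewrite -[a *: x]addr0 (coords_lin coP) ?coords0 ?addr0 //; exact: submodule0.
Qed.

Lemma coordsB x y i : N x -> N y -> co (x - y) i = co x i - co y i.
Proof.
by move=> Nx Ny; rewrite addrC -scaleN1r (coords_lin coP) // mulN1r addrC.
Qed.

Lemma coords_eq x y : N x -> N y -> (forall i, co x i = co y i) -> x = y.
Proof.
move=> Nx Ny e; apply/eqP; rewrite -subr_eq0; apply/eqP.
by apply: (coords_inj coP); [exact: submoduleB | move=> i; rewrite coordsB // e subrr].
Qed.

Lemma coords_component x (P : pred I) : N x ->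
  exists2 y, N y & forall i, co y i = if P i then co x i else 0.
Proof.
move=> Nx; have [s sP] := coords_fin coP Nx.
apply: (coords_sur coP (s := s)) => i; case: ifP => _; rewrite ?eqxx //.
- exact: (coords_mem coP).
- exact: rpred0.
- exact: sP.
Qed.

Section LocalSplitting.
Variables (R_pruefer : pruefer R) (R_hlocal : h_local R).
Variables (m : ideal R) (mm : maximal_ideal m) (x : M) (Nx : N x).

Let scaled (a : R) (i : I) : set R := [set z | exists2 y, y \in J i & z = a * y].

Let scaled_ideal a i : is_ideal (scaled a i).
Proof.
split; first by exists 0; rewrite ?rpred0 ?mulr0.
move=> k _ _ [y yJ ->] [z zJ ->]; exists (k * y + z).
  by rewrite rpredD ?(rpredZ k).
by rewrite mulrDr mulrCA.
Qed.

(* x_i^-1 J_i is contained in x_j^-1 J_j after localising at m. *)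
Let le i j := exists2 t, t \notin m & forall y, y \in J i ->
  exists2 z, z \in J j & t * (co x j * y) = co x i * z.

(** Multiplying the fractional ideals x_i^-1 J_i and x_j^-1 J_j by x_i x_j gives the ideals x_j J_i
    and x_i J_j of R. The second contains the nonzero x_i x_j, so [loc_le_uniform] turns the
    pointwise comparison at [m] into one with a single factor. *)
Let le_total i j : co x i != 0 -> co x j != 0 -> le i j \/ le j i.
Proof.
have half i' j' : co x i' != 0 -> co x j' != 0 ->
    loc_le m (scaled (co x j') i') (scaled (co x i') j') -> le i' j'.
  move=> xi xj lij.
  have [|||t tm tP] := loc_le_uniform (c := co x i' * co x j') R_hlocal mm _ _ _ lij.
  - exact: scaled_ideal.
  - exact: mulf_neq0.
  - by exists (co x j') => //; exact: (coords_mem coP).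
  exists t => // y yJ; have [|z zJ e] := tP (co x j' * y); first by exists y.
  by exists z.
move=> xi xj; have [l|l] := loc_le_total R_pruefer mm (scaled_ideal (co x j) i) (scaled_ideal (co x i) j).
  by left; exact: half.
by right; exact: half.
Qed.

Let le_trans i j k : co x j != 0 -> le i j -> le j k -> le i k.
Proof.
move=> xj [t tm tP] [t' tm' tP']; exists (t' * t); first exact: maximal_mul.
move=> y yJ; have [z zJ e] := tP y yJ; have [w wJ e'] := tP' z zJ.
exists w => //; apply: (mulfI xj).
transitivity (t' * co x k * (t * (co x j * y))).
  by rewrite -!mulrA mulrCA; congr (_ * _); rewrite mulrCA [RHS]mulrCA; congr (_ * _); rewrite mulrCA.
by rewrite e mulrCA -mulrA e' mulrCA.
Qed.

(** With [i] a coordinate in the support of [x] that is minimal for [le], the map sends y to t (y_i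
    / x_i) x. It depends on y_i only, which gives the last clause. *)
Lemma local_splitting : exists t phi, [/\ t \notin m, lin_on N phi, phi x = t *: x,
  forall y, N y -> line x (phi y) &
  forall y, N y -> (forall i, co x i != 0 -> co y i = 0) -> phi y = 0].
Proof.
have [x0|/eqP x0] := pselect (x = 0).
  exists 1, (fun=> 0); split=> //; first by case: mm.
  - by move=> a u v _ _; rewrite scaler0 addr0.
  - by rewrite x0 scaler0.
  - by move=> y _; exact: submodule0 (submodule_line x).
have [s0 s0P] := coords_fin coP Nx.
pose s := [seq i <- s0 | co x i != 0].
have sE i : (i \in s) = (co x i != 0).
  by rewrite mem_filter; case: eqVneq => //= /s0P ->.
have sne : s != [::].
  apply/negP => /eqP s_0; move/eqP: x0; apply; apply: (coords_inj coP) => // i.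
  by apply/eqP; rewrite -[_ == _]negbK -sE s_0.
have [||//|i is_ imin] := @seq_least _ le s.
- by move=> i j; rewrite !sE; exact: le_total.
- by move=> i j k; rewrite !sE => _ xj _; exact: le_trans.
(* The support of [x] is finite, so the product of the factors for the single coordinates works for
   all of them. *)
have [t tm tP] : exists2 t, t \notin m & {in s, forall j y, y \in J i ->
    exists2 z, z \in J j & t * (co x j * y) = co x i * z}.
  elim: s imin {sE sne is_} => [|j q IH] imin; first by exists 1 => //; case: mm.
  have [t tm tP] := IH (fun k kq => imin k (mem_behead (s := j :: q) kq)).
  have [t' tm' tP'] := imin j (mem_head _ _).
  exists (t' * t); first exact: maximal_mul.
  move=> k; rewrite in_cons => /orP[/eqP -> |kq] y yJ.
    have [z zJ e] := tP' y yJ; exists (t * z); first exact: (rpredZ t).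
    by rewrite -mulrA mulrCA e mulrCA.
  have [z zJ e] := tP k kq y yJ; exists (t' * z); first exact: (rpredZ t').
  by rewrite -mulrA e mulrCA.
have xi : co x i != 0 by rewrite -sE.
(* [z] is t (y_i / x_i) x. Its coordinates t x_j y_i / x_i lie in J_j by the choice of [t], so it
   exists in [N]. *)
have ex y : exists z, N y -> N z /\ co x i *: z = (t * co y i) *: x.
  have [Ny|] := pselect (N y); last by exists 0.
  have exg j : exists z : R, z \in J j /\ (j \in s -> t * (co x j * co y i) = co x i * z).
    have [js|js] := boolP (j \in s); last by exists 0; split; first exact: rpred0.
    by have [z zJ e] := tP j js (co y i) (coords_mem coP i Ny); exists z.
  have [g gP] := choice exg.
  have [||z Nz ez] := @coords_sur _ _ _ _ _ _ coP (fun j => if j \in s then g j else 0) s.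
  - by move=> j; case: ifP => _; [case: (gP j) | exact: rpred0].
  - by move=> j; case: ifP => //; rewrite eqxx.
  exists z => _; split=> //; apply: coords_eq; [exact: submoduleZ|exact: submoduleZ|].
  move=> j; rewrite !coordsZ // ez; case: ifP => js.
    by have [_ <-//] := gP j; rewrite -mulrA (mulrC (co y i)).
  by move/negbT: js; rewrite sE negbK => /eqP ->; rewrite !mulr0.
have [phi phiP] := choice ex.
exists t, phi; split=> //.
- move=> a u v Nu Nv; apply: (tfI M_tf xi).
  have Nuv : N (a *: u + v) by exact: sN.2.
  rewrite scalerDr scalerA mulrC -scalerA (phiP _ Nuv).2 (phiP _ Nu).2 (phiP _ Nv).2.
  by rewrite scalerA -scalerDl (coords_lin coP) // mulrDr mulrCA.
- by apply: (tfI M_tf xi); rewrite (phiP _ Nx).2 scalerA mulrC.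
- by move=> y Ny; exists (co x i), (t * co y i); split=> //; case: (phiP y Ny).
- move=> y Ny y0; apply: (tf0 M_tf xi).
  by rewrite (phiP _ Ny).2 y0 // mulr0 scale0r.
Qed.

End LocalSplitting.

(** By [lin_on_line] a [phi] fixing [x] fixes the whole line, so it is a projection of [N] onto
    [line x]. The vanishing clause survives linear combinations and is carried along in [W]; it
    later makes [phi] vanish on a given partial sum. *)
Lemma line_splitting (x : M) : pruefer R -> h_local R -> N x ->
  exists phi, [/\ lin_on N phi, phi x = x, forall y, N y -> line x (phi y) &
    forall y, N y -> (forall i, co x i != 0 -> co y i = 0) -> phi y = 0].
Proof.
move=> pR hR Nx.
pose W : set R := [set r | exists phi, [/\ lin_on N phi, phi x = r *: x,
  forall y, N y -> line x (phi y) &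
  forall y, N y -> (forall i, co x i != 0 -> co y i = 0) -> phi y = 0]].
suff : W 1 by move=> [phi]; rewrite scale1r; exists phi.
have sl := submodule_line x.
apply: ideal_full.
  split.
    exists (fun=> 0); split=> //.
    - by move=> a u v _ _; rewrite scaler0 addr0.
    - by rewrite scale0r.
    - by move=> y _; exact: submodule0.
  move=> a r r' [p [pl px pL p0]] [p' [pl' px' pL' p0']].
  exists (fun y => a *: p y + p' y); split.
  - move=> b u v Nu Nv; rewrite pl // pl' // !scalerDr addrACA; congr (_ + _ + _).
    by rewrite !scalerA mulrC.
  - by rewrite px px' scalerDl scalerA.
  - by move=> y Ny; apply: sl.2; [exact: pL|exact: pL'].
  - by move=> y Ny y0; rewrite p0 // p0' // scaler0 addr0.
move=> m mm; have [t [phi [tm *]]] := local_splitting pR hR mm Nx.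
by exists t => //; exists phi.
Qed.

End Coords.

(** * Pure closures of countable rank and good submodules *)

Lemma countable_image T T' (f : T -> T') (A : set T) :
  countable A -> countable (f @` A).
Proof. by apply: sub_countable; exact: card_image_le. Qed.

Lemma countable_setU T (A B : set T) : countable A -> countable B ->
  countable (A `|` B).
Proof.
move=> cA cB; rewrite -bigcup2E; apply: bigcup_countable => [|[|[|n]] _] //=.
Qed.

Section Closure.
Variables (R : idomainType) (M : lmodType R).
Implicit Types (A N H Y : set M).

(** The pure closure of A + H, as an intersection: minimality and monotonicity are then immediate,
    and [cl_exts] gives the description from below. *)
Definition cl A H : set M := [set y | forall N, submodule N -> rd_pure N ->
  A `<=` N -> H `<=` N -> N y].

Lemma submodule_cl A H : submodule (cl A H).
Proof.
split=> [N sN _ _ _|a x y Cx Cy N sN pN AN HN]; first exact: submodule0.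
by apply: sN.2; [exact: Cx | exact: Cy].
Qed.

Lemma rd_pure_cl A H : rd_pure (cl A H).
Proof. by move=> a x a0 Cx N sN pN AN HN; apply: (pN a) => //; exact: Cx. Qed.

Lemma cl_subl A H : A `<=` cl A H.
Proof. by move=> x Ax N _ _ + _; apply. Qed.

Lemma cl_subr A H : H `<=` cl A H.
Proof. by move=> x Ax N _ _ _; apply. Qed.

Lemma cl_min A H N : submodule N -> rd_pure N -> A `<=` N -> H `<=` N -> cl A H `<=` N.
Proof. by move=> sN pN AN HN x; apply. Qed.

Lemma cl_mono A H H' : H `<=` H' -> cl A H `<=` cl A H'.
Proof.
move=> HH'; apply: cl_min; [exact: submodule_cl|exact: rd_pure_cl|exact: cl_subl|].
by move=> x /HH'; exact: cl_subr.
Qed.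

Lemma total_on_nat (T : Type) (F : nat -> set T) : (forall n, F n `<=` F n.+1) ->
  (forall i j, (i <= j)%N -> F i `<=` F j) /\ total_on (range F) subset.
Proof.
move=> Fs; have Fm i j : (i <= j)%N -> F i `<=` F j.
  move=> /subnK <-; elim: (j - i)%N => // n IH x /IH; exact: Fs.
split=> // _ _ [i _ <-] [j _ <-].
by case/orP: (leq_total i j) => /Fm; [left|right].
Qed.

Lemma cl_bigcup A (H : nat -> set M) : (forall n, H n `<=` H n.+1) ->
  cl A (\bigcup_n H n) = \bigcup_n cl A (H n).
Proof.
move=> Hs; apply/seteqP; split; last first.
  by move=> x [n _]; apply: cl_mono => y Hy; exists n.
have [_ tot] := total_on_nat (fun n => cl_mono (A := A) (Hs n)).
have e : \bigcup_n cl A (H n) = \bigcup_(X in range (fun n => cl A (H n))) X.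
  by rewrite bigcup_image.
apply: cl_min; rewrite ?e.
- apply: submodule_bigcup => //; first by exists (cl A (H 0%N)); exists 0%N.
  by move=> _ [n _ <-]; exact: submodule_cl.
- by apply: rd_pure_bigcup => _ [n _ <-]; exact: rd_pure_cl.
- by move=> x Ax; exists (cl A (H 0%N)); [exists 0%N|exact: cl_subl].
- by move=> x [n _ Hx]; exists (cl A (H n)); [exists n|exact: cl_subr].
Qed.

Fixpoint exts A (h : nat -> M) k : set M :=
  if k is k'.+1 then ext (exts A h k') (h k') else A.

Lemma submodule_exts A h k : submodule A -> submodule (exts A h k).
Proof. by move=> sA; elim: k => //= k; exact: submodule_ext. Qed.

Lemma rd_pure_exts A h k : rd_pure A -> rd_pure (exts A h k).
Proof. by move=> pA; case: k => //= k; exact: rd_pure_ext. Qed.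

Lemma cl_exts A h : submodule A -> rd_pure A ->
  cl A (range h) = \bigcup_k exts A h k.
Proof.
move=> sA pA; apply/seteqP; split; last first.
  move=> x [k _]; elim: k x => [|k IH] x /=; first exact: cl_subl.
  move: x; apply: ext_min => //; [exact: submodule_cl|exact: rd_pure_cl|].
  by apply: cl_subr; exists k.
have [_ tot] := total_on_nat (fun n => @ext_sub _ _ (exts A h n) (h n)).
have e : \bigcup_k exts A h k = \bigcup_(X in range (exts A h)) X.
  by rewrite bigcup_image.
apply: cl_min; rewrite ?e.
- apply: submodule_bigcup => //; first by exists A; exists 0%N.
  by move=> _ [n _ <-]; exact: submodule_exts.
- by apply: rd_pure_bigcup => _ [n _ <-]; exact: rd_pure_exts.
- by move=> x Ax; exists A => //; exists 0%N.
- move=> _ [k _ <-]; exists (exts A h k.+1); first by exists k.+1.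
  exact/ext_mem/submodule_exts.
Qed.

(** The value 0 fills the indices that enumerate nothing, so an empty [H] is covered too; a pure
    closure does not notice the extra 0. *)
Lemma countable_enum H : countable H -> exists h : nat -> M,
  H `<=` range h /\ forall n, H (h n) \/ h n = 0.
Proof.
move=> /countable_injP[f finj].
have ex n : exists y, (H y \/ y = 0) /\ forall x, H x -> f x = n -> y = x.
  have [[x [Hx fx]]|nx] := pselect (exists x, H x /\ f x = n).
    exists x; split; [by left|move=> x' Hx' fx'; apply: finj; rewrite ?inE // fx //].
  by exists 0; split; [right|move=> x Hx fx; case: nx; exists x].
have [h hP] := choice ex; exists h; split; last by move=> n; case: (hP n).
by move=> x Hx; exists (f x) => //; apply: (hP (f x)).2.
Qed.

(* The rank of (cl A H `&` Y) / (A `&` Y) is countable: G is a maximal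
   independent set, chosen along the filtration of cl A H by rank-one steps. *)
Lemma countable_rank_sub A H Y : submodule A -> rd_pure A -> submodule Y ->
  countable H -> exists G, [/\ countable G, G `<=` Y &
    forall N, submodule N -> rd_pure N -> A `&` Y `<=` N -> G `<=` N ->
      cl A H `&` Y `<=` N].
Proof.
move=> sA pA sY /countable_enum[h [Hh _]].
(* For each rank-one step, [y] is an element of [Y] that is new at this step, if there is one, and 0
   otherwise. *)
have exy k : exists y, Y y /\ exts A h k.+1 y /\
    ((exists z, [/\ Y z, exts A h k.+1 z & ~ exts A h k z]) -> ~ exts A h k y).
  have [[z [? ? ?]]|nz] := pselect (exists z, [/\ Y z, exts A h k.+1 z & ~ exts A h k z]).
    by exists z.
  exists 0; split; first exact: submodule0.
  by split=> //; apply: submodule0; exact: submodule_exts.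
have [y yP] := choice exy; exists (range y); split.
- exact: countable_image.
- by move=> _ [k _ <-]; case: (yP k).
move=> N sN pN AN GN z [Hz Yz].
have [k _] : (\bigcup_k exts A h k) z by rewrite -cl_exts //; apply: cl_mono Hz.
elim: k z Yz {Hz} => [|k IH] z Yz; first by move=> Az; apply: AN.
have [Ez|nEz Ez] := pselect (exts A h k z); first by move=> _; exact: IH.
have [Yy [Ey /(_ _)nEy]] := yP k; have {}nEy : ~ exts A h k (y k) by apply: nEy; exists z.
have Ny : N (y k) by apply: GN; exists k.
have sE := submodule_exts h k sA; have pE := @rd_pure_exts A h k pA.
move: Ez Ey => /= [r [b [r0 Ez]]] [r' [b' [r'0 Ey]]].
have b'0 : b' != 0.
  apply/eqP => b'0; apply: nEy; apply: (pE r') => //.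
  by move: Ey; rewrite b'0 scale0r subr0.
apply: (pN (b' * r)); first exact: mulf_neq0.
(* Both [z] and [y k] are, up to multiples, congruent to multiples of [h k] modulo the previous
   step. Eliminating [h k] leaves an element of [Y] at the previous step, to which induction
   applies; b' is nonzero because [y k] is new. *)
have : N (b' *: (r *: z) - b *: (r' *: y k)).
  apply: IH; first by do !(apply: submoduleB || apply: submoduleZ).
  have -> : b' *: (r *: z) - b *: (r' *: y k) =
      b' *: (r *: z - b *: h k) - b *: (r' *: y k - b' *: h k).
    by rewrite !scalerBr opprB !scalerA (mulrC b' b) [RHS]addrA subrK.
  by apply: submoduleB => //; exact: submoduleZ.
move=> Nd; rewrite -scalerA -(subrK (b *: (r' *: y k)) (b' *: (r *: z))).
by apply: submoduleD => //; do 2!apply: submoduleZ => //.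
Qed.

(* A G(aleph_0)-family of pure submodules between L and U, with relative
   countable generation phrased against a pure N absorbing the generators G'. *)
Record pure_family (L U : set M) (E : set (set M)) : Prop := {
  family_submod : forall D, E D -> submodule D;
  family_pure : forall D, E D -> rd_pure D;
  family_ge : forall D, E D -> L `<=` D;
  family_le : forall D, E D -> D `<=` U;
  family_low : E L;
  family_chain : forall F, F !=set0 -> F `<=` E -> total_on F subset ->
    E (\bigcup_(D in F) D);
  family_step : forall D G, E D -> countable G -> G `<=` U ->
    exists D' G', [/\ E D', D `<=` D', G `<=` D', countable G' &
      forall N, submodule N -> rd_pure N -> D `<=` addm N L -> G' `<=` N ->
        D' `<=` addm N L] }.

Section Families.
Variables (K : countType) (L U : K -> set M) (E : K -> set (set M)).
Hypothesis sL : forall k, submodule (L k).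
Hypothesis sU : forall k, submodule (U k).
Hypothesis EP : forall k, pure_family (L k) (U k) (E k).

(** The sum of A [&] U_k and L_k is the preimage in U_k of the image of A [&] U_k in U_k / L_k. With
    L_k = 0 the same formula expresses a condition on A [&] U_k itself, so both kinds of condition
    are treated together. *)
Definition good A := [/\ submodule A, rd_pure A & forall k, E k (addm (A `&` U k) (L k))].

Lemma family_LU k : L k `<=` U k.
Proof. exact: (family_le (EP k) (family_low (EP k))). Qed.

Let st := (set M * (K -> set M))%type.

(** A stage consists of a countable set H and members D_k of the families, each squeezed between A
    [&] U_k and cl A H + L_k. *)
Let inv A (s : st) := [/\ countable s.1, (forall k, E k (s.2 k)),
  (forall k, A `&` U k `<=` s.2 k) & (forall k, s.2 k `<=` addm (cl A s.1) (L k))].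

(** The new D_k catches what the old closure has in U_k. In the limit of the stages this and [inv]
    become two opposite inclusions. *)
Let next A (s s' : st) := [/\ s.1 `<=` s'.1, (forall k, s.2 k `<=` s'.2 k) &
  (forall k, cl A s.1 `&` U k `<=` s'.2 k)].

Let inv_next A s : good A -> inv A s -> exists s', inv A s' /\ next A s s'.
Proof.
move=> [sA pA _]; case: s => H D [/= cH ED AD DH].
have ex k : exists DG : set M * set M, [/\ E k DG.1, D k `<=` DG.1, countable DG.2,
    (cl A H `&` U k `<=` DG.1) &
    forall N, submodule N -> rd_pure N -> D k `<=` addm N (L k) -> DG.2 `<=` N ->
        DG.1 `<=` addm N (L k)].
  (* [G] represents cl A H [&] U_k by countably many elements. The generators [G'] of the enlarged
     family member are put into the next H, which keeps that member below the next closure plus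
     L_k. *)
  have [G [cG GU GP]] := countable_rank_sub sA pA (sU k) cH.
  have [D' [G' [ED' DD' GD' cG' D'P]]] := family_step (EP k) (ED k) cG GU.
  exists (D', G'); split=> //=; apply: GP => //.
  - exact: (family_submod (EP k) ED').
  - exact: (family_pure (EP k) ED').
  - by move=> x /AD /DD'.
have [f fP] := choice ex.
pose H' := H `|` \bigcup_k (f k).2.
have HH' : H `<=` H' by move=> x; left.
exists (H', fun k => (f k).1); split; split=> //=.
- rewrite /H'; apply: countable_setU => //; apply: bigcup_countable => [|k _].
    exact: countableP.
  by case: (fP k).
- by move=> k; case: (fP k).
- by move=> k x /AD; have [_ + _ _ _] := fP k; apply.
- move=> k; have [_ _ _ _] := fP k; apply; [exact: submodule_cl|exact: rd_pure_cl| |].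
    by apply: subset_trans (DH k) _; apply: addmS => //; exact: cl_mono.
  by move=> x Gx; apply: cl_subr; right; exists k.
- by move=> k; case: (fP k).
- by move=> k; case: (fP k).
Qed.

(** The stages are iterated from H = {x}. The union of the sets H is countable, and [h] enumerates
    it. *)
Lemma good_extend A x : good A -> exists h : nat -> M,
  good (cl A (range h)) /\ cl A (range h) x.
Proof.
move=> gA; have [sA pA EA] := gA.
have ex s : exists s', inv A s -> inv A s' /\ next A s s'.
  have [i|ni] := pselect (inv A s); last by exists s.
  by have [s' s'P] := inv_next gA i; exists s'.
have [f fP] := choice ex.
pose s0 : st := ([set x], fun k => addm (A `&` U k) (L k)).
pose s n := iter n f s0.
have is0 : inv A s0.
  split=> //=; first by move=> k; exact: addm_subl.
  move=> k; apply: addmS => // y [Ay _]; exact: cl_subl.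
have is_ n : inv A (s n) by elim: n => //= n /fP[].
have ns n : next A (s n) (s n.+1) by exact: (fP _ (is_ n)).2.
have Hs n : (s n).1 `<=` (s n.+1).1 by case: (ns n).
have cl_eq := cl_bigcup A Hs.
pose H := \bigcup_n (s n).1; rewrite -/H in cl_eq.
have cH : countable H.
  by apply: bigcup_countable => [|n _]; [exact: countableP | case: (is_ n)].
have [h [Hh hH]] := countable_enum cH.
have clh : cl A (range h) = cl A H.
  apply/seteqP; split; last exact: cl_mono.
  apply: cl_min; [exact: submodule_cl|exact: rd_pure_cl|exact: cl_subl|].
  move=> _ [n _ <-]; have [|->] := hH n; first exact: cl_subr.
  exact: (submodule0 (submodule_cl A H)).
exists h; rewrite clh; split; last by apply: cl_subr; exists 0%N.
split; [exact: submodule_cl|exact: rd_pure_cl|move=> k].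
have mono n : (s n).2 k `<=` (s n.+1).2 k by case: (ns n).
have [_ tot] := @total_on_nat _ (fun n => (s n).2 k) mono.
(* The trace of the limit closure is the union of the interleaved D_k, a chain in [E k]. *)
rewrite (_ : addm _ _ = \bigcup_(D in range (fun n => (s n).2 k)) D).
  apply: (family_chain (EP k)) => //; first by exists ((s 0%N).2 k); exists 0%N.
  by move=> _ [n _ <-]; case: (is_ n).
have ED n : E k ((s n).2 k) by case: (is_ n).
rewrite bigcup_image; apply/seteqP; split=> [_ [u [l [[Cu Uu] Ll ->]]]|y [n _ Dy]].
  move: Cu; rewrite cl_eq => -[n _ Cu]; exists n.+1 => //; apply: submoduleD.
  - exact: (family_submod (EP k) (ED n.+1)).
  - by have [_ _ +] := ns n; apply.
  - exact: (family_ge (EP k) (ED n.+1) Ll).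
have [_ _ _ /(_ k y Dy)[u [l [Cu Ll ey]]]] := is_ n.
exists u, l; split=> //; split; first by rewrite cl_eq; exists n.
have -> : u = y - l by rewrite ey addrK.
apply: submoduleB => //; last exact: family_LU.
exact: (family_le (EP k) (ED n) Dy).
Qed.

Lemma good0 : torsion_free M -> good [set 0].
Proof.
move=> tf; split; [exact: submodule_set0|exact: rd_pure0|move=> k].
rewrite (_ : addm _ _ = L k); first exact: family_low (EP k).
apply/seteqP; split=> [_ [_ [l [[/= -> _] Ll ->]]]|x Lx]; first by rewrite add0r.
by exists 0, x; rewrite add0r; split=> //; split=> //; exact: submodule0.
Qed.

Lemma good_bigcup (F : set (set M)) : F !=set0 -> (forall A, F A -> good A) ->
  total_on F subset -> good (\bigcup_(A in F) A).
Proof.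
move=> F0 Fg Ft; split.
- by apply: submodule_bigcup => // A /Fg[].
- by apply: rd_pure_bigcup => A /Fg[].
move=> k; pose f A := addm (A `&` U k) (L k).
rewrite (_ : addm _ _ = \bigcup_(D in f @` F) D).
  apply: (family_chain (EP k)).
  - by case: F0 => A FA; exists (f A); exists A.
  - by move=> _ [A /Fg[_ _ gA] <-]; exact: gA.
  - move=> _ _ [A FA <-] [B FB <-]; have [AB|BA] := Ft _ _ FA FB; [left|right];
      by apply: addmS => // x [? ?]; split=> //; [exact: AB || exact: BA].
rewrite bigcup_image; apply/seteqP; split.
  by move=> _ [u [l [[[A FA Au] Uu] Ll ->]]]; exists A => //; exists u, l.
by move=> _ [A FA [u [l [[Au Uu] Ll ->]]]]; exists u, l; split=> //; split=> //; exists A.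
Qed.

End Families.
End Closure.

(** * Partial sums of a direct sum of ideals *)

Section PartialSums.
Variables (R : idomainType) (M : lmodType R).
Variables (N : set M) (sN : submodule N) (pN : rd_pure N).
Variables (I : choiceType) (J : I -> ideal R) (co : M -> I -> R).
Hypothesis coP : coords N J co.

Definition summand i : set M := [set z | N z /\ forall j, j != i -> co z j = 0].

(** Avoids naming an index set: D is the sum of the summands at the coordinates where some element
    of D is nonzero. *)
Definition partial_sum (D : set M) := [/\ submodule D, D `<=` N &
  forall y i, D y -> co y i != 0 -> summand i `<=` D].

(** Induction on a list containing the support of [y], splitting off one component at a time. *)
Lemma coords_span C y : submodule C -> N y ->
  (forall i, co y i != 0 -> summand i `<=` C) -> C y.
Proof.
move=> sC Ny; have [s] := coords_fin coP Ny.
elim: s y Ny => [|i s IH] y Ny ys yC.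
  have -> : y = 0; last exact: submodule0.
  by apply: (coords_inj coP) => // j; apply/eqP; rewrite -[_ == _]negbK; apply/negP => /ys.
have [y1 Ny1 e1] := coords_component coP (pred1 i) Ny.
have [y2 Ny2 e2] := coords_component coP (predC1 i) Ny.
have -> : y = 1 *: y1 + y2.
  apply: (coords_eq sN coP) => // [|j]; first exact: sN.2.
  by rewrite (coords_lin coP) // mul1r e1 e2 /=; case: eqP => _; rewrite ?addr0 ?add0r.
apply: sC.2.
  have [yi|/yC] := eqVneq (co y i) 0.
    have -> : y1 = 0; last exact: submodule0.
    by apply: (coords_inj coP) => // j; rewrite e1 /=; case: eqP => [->|].
  by apply; split=> // j /negPf ji; rewrite e1 /= ji.
apply: IH => // j; rewrite e2 /=; (have [_|ji] := eqVneq j i; first by rewrite eqxx) => /=.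
  by move=> /ys; rewrite in_cons (negPf ji).
exact: yC.
Qed.

Lemma partial_sum_rd_pure D : partial_sum D -> rd_pure D.
Proof.
move=> [sD DN DP] a y a0 Day; have Ny : N y by apply: (pN a0); exact: DN.
apply: coords_span => // i yi; apply: (DP (a *: y)) => //.
by rewrite (coordsZ sN coP) // mulf_neq0.
Qed.

(** To absorb a countable [G], all coordinates in the finite supports of its elements are adjoined.
    The nonzero components of these elements are the countably many generators. *)
Lemma partial_sum_family : pure_family [set 0] N partial_sum.
Proof.
split.
- by move=> D [].
- exact: partial_sum_rd_pure.
- by move=> D [sD _ _] _ /= ->; exact: submodule0.
- by move=> D [].
- split; first exact: submodule_set0.
    by move=> _ /= ->; exact: submodule0.
  by move=> y i /= ->; rewrite (coords0 sN coP) eqxx.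
- move=> F F0 FE Ft; split.
  + by apply: submodule_bigcup => // D /FE[].
  + by move=> y [D /FE[_ DN _]]; exact: DN.
  + move=> y i [D FD Dy] yi z sz; exists D => //.
    by have [_ _ /(_ y i Dy yi)] := FE D FD; apply.
move=> D G [sD DN DP] cG GN.
pose S i := summand i `<=` D \/ exists2 g, G g & co g i != 0.
pose D' : set M := [set y | N y /\ forall i, co y i != 0 -> S i].
pose comp g i : M := xget 0 [set z | N z /\ forall j, co z j = if j == i then co g i else 0].
have compP g i : N g -> N (comp g i) /\ forall j, co (comp g i) j = if j == i then co g i else 0.
  move=> Ng; have [y Ny e] := coords_component coP (pred1 i) Ng.
  apply: (@xgetPex M 0 [set z | N z /\ forall j, co z j = if j == i then co g i else 0]).
  by exists y; split=> // j; rewrite e /=; case: eqP => [->|].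
have exs g : exists s : seq I, N g -> forall i, co g i != 0 -> i \in s.
  have [Ng|] := pselect (N g); last by exists [::].
  by have [s sP] := coords_fin coP Ng; exists s.
have [s sP] := choice exs.
pose G' := \bigcup_(g in G) (comp g @` [set` s g]).
have sD' : submodule D'.
  split; first by split=> [|i]; [exact: submodule0|rewrite (coords0 sN coP) eqxx].
  move=> a x y [Nx xS] [Ny yS]; split; first exact: sN.2.
  move=> i; rewrite (coords_lin coP) // => nz.
  have [xi|] := eqVneq (co x i) 0; last exact: xS.
  by apply: yS; move: nz; rewrite xi mulr0 add0r.
exists D', G'; split.
- split=> //; first by move=> y [].
  move=> y i [Ny yS] yi z [Nz zi]; split=> // j; have [-> _|/zi ->] := eqVneq j i; first exact: yS.
  by rewrite eqxx.
- by move=> y Dy; split; [exact: DN|move=> i yi; left; exact: DP yi].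
- by move=> g Gg; split; [exact: GN|move=> i gi; right; exists g].
- apply: bigcup_countable => // g _; apply: countable_image.
  exact: finite_set_countable (finite_seq _).
move=> C sC pC DC GC y [Ny yS]; apply: (addm_subl (submodule_set0 M)).
have DC' : D `<=` C by move=> d /DC[u [_ [Cu /= -> ->]]]; rewrite addr0.
apply: coords_span => // i /yS[sDi|[g Gg gi]] z; first by move=> /sDi /DC'.
move=> [Nz zi]; apply: (pC (co g i)) => //.
have [Nc cE] := compP g i (GN _ Gg).
(* A summand has rank one, so a pure submodule containing one nonzero component at [i] contains all
   of it. *)
have -> : co g i *: z = co z i *: comp g i.
  apply: (coords_eq sN coP); [exact: submoduleZ|exact: submoduleZ|move=> j].
  rewrite !(coordsZ sN coP) // cE; have [->|ji] := eqVneq j i; first by rewrite mulrC.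
  by rewrite zi // !mulr0.
apply: submoduleZ => //; apply: GC; exists g => //; exists i => //=.
exact: sP (GN _ Gg) _ gi.
Qed.

End PartialSums.

(** * Splitting rank-one pure submodules off one after another *)

Section Splitting.
Variables (R : idomainType) (M : lmodType R) (M_tf : torsion_free M).
Implicit Types (A N : set M).

(* A is a summand of N, and in the complement N / A the pure closure of every
   element is again a summand. *)
Definition split_over A N := forall h, N h -> exists x phi,
  [/\ A (h - x), lin_on N phi, (forall y, A y -> phi y = 0), phi x = x &
      forall y, N y -> line x (phi y)].

Variables (A N : set M) (h : M).
Hypotheses (sA : submodule A) (pA : rd_pure A) (sN : submodule N) (pN : rd_pure N).
Hypotheses (AN : A `<=` N) (Nh : N h).

Lemma split_mem x : A (h - x) -> N x.
Proof. by move=> Ahx; rewrite -(subKr h x); apply: submoduleB => //; exact: AN. Qed.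

Lemma split_line_ext x : A (h - x) -> line x `<=` ext A h.
Proof.
move=> Ahx; have sE := submodule_ext h sA.
apply: line_min => //; first exact: rd_pure_ext.
by rewrite -(subKr h x); apply: (submoduleB sE); [exact: ext_mem|exact: ext_sub].
Qed.

(** A multiple a y is congruent to b x modulo A. Since [phi] kills A and fixes x, a (y - phi y) is
    in A, and purity removes a. *)
Lemma split_residue x phi y : A (h - x) -> lin_on N phi ->
  (forall y, A y -> phi y = 0) -> phi x = x -> ext A h y -> A (y - phi y).
Proof.
move=> Ahx phil phiA phix Ey; have Nx := split_mem Ahx.
have Ny : N y by move: y Ey; apply: ext_min.
case: Ey => [a [b [a0 Ay]]]; apply: (pA a0); rewrite scalerBr -(lin_onZ a sN phil Ny).
have Ayx : A (a *: y - b *: x).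
  have -> : a *: y - b *: x = (a *: y - b *: h) + b *: (h - x).
    by rewrite scalerBr addrA subrK.
  by apply: submoduleD => //; exact: submoduleZ.
have /eqP := phiA _ Ayx; rewrite (lin_onB sN phil) ?(lin_onZ b sN phil Nx) ?phix; last 2 first.
- exact: submoduleZ.
- exact: submoduleZ.
by rewrite subr_eq0 => /eqP ->.
Qed.

Lemma split_over_decomp : split_over A N -> exists x,
  ext A h = addm A (line x) /\ forall y, A y -> line x y -> y = 0.
Proof.
move=> /(_ _ Nh)[x [phi [Ahx phil phiA phix phiL]]].
have Nx := split_mem Ahx; have lN : line x `<=` N by exact: line_min.
exists x; split=> //; last first.
  by move=> y Ay xy; rewrite -(lin_on_line M_tf sN phil Nx (lN _ xy) xy phix) phiA.
apply/seteqP; split.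
  move=> y Ey; have Ny : N y by move: y Ey; apply: ext_min.
  exists (y - phi y), (phi y); split; [|exact: phiL|by rewrite subrK].
  exact: (split_residue Ahx).
apply: addm_sub; [exact: submodule_ext|exact: ext_sub|exact: split_line_ext].
Qed.

(** This lets the steps be iterated inside a fixed [N]. The given [k] is first corrected by [phi] to
    k', and the hypothesis yields [z] and [psi] for k'. As phi z = 0, the map psi (1 - phi) fixes
    [z], and it kills [ext A h] because 1 - phi maps that into A. *)
Lemma split_over_ext : split_over A N -> split_over (ext A h) N.
Proof.
move=> spl; have [x [phi [Ahx phil phiA phix phiL]]] := spl _ Nh.
have Nx := split_mem Ahx; have lN : line x `<=` N by exact: line_min.
have phiN y : N y -> N (phi y) by move=> Ny; apply: lN; exact: phiL.
have phiphi y : N y -> phi (phi y) = phi y.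
  by move=> Ny; apply: (lin_on_line M_tf sN phil Nx) => //; [exact: phiN|exact: phiL].
move=> k Nk; pose k' := k - phi k.
have Nk' : N k' by apply: submoduleB => //; exact: phiN.
have [z [psi [Az psil psiA psiz psiL]]] := spl _ Nk'.
have Nz : N z by rewrite -(subKr k' z); apply: submoduleB => //; exact: AN.
have phiz : phi z = 0.
  rewrite -(subKr k' z) (lin_onB sN phil) //; last exact: AN.
  rewrite (phiA _ Az) subr0 (lin_onB sN phil) //; last exact: phiN.
  by rewrite phiphi // subrr.
exists z, (fun y => psi (y - phi y)); split.
- have -> : k - z = (k' - z) + phi k by rewrite addrAC subrK.
  apply: submoduleD; [exact: submodule_ext|exact: ext_sub|].
  by apply: (split_line_ext Ahx); exact: phiL.
- move=> a u v Nu Nv; rewrite phil // opprD addrACA -scalerBr psil //.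
    by apply: submoduleB => //; exact: phiN.
  by apply: submoduleB => //; exact: phiN.
- by move=> y Ey; apply: psiA; exact: (split_residue Ahx).
- by rewrite phiz subr0.
- by move=> y Ny; apply: psiL; apply: submoduleB => //; exact: phiN.
Qed.

End Splitting.

Section SplitOverPartialSum.
Variables (R : idomainType) (M : lmodType R) (M_tf : torsion_free M).
Variables (R_pruefer : pruefer R) (R_hlocal : h_local R).
Variables (N : set M) (sN : submodule N).
Variables (I : choiceType) (J : I -> ideal R) (co : M -> I -> R).
Hypothesis coP : coords N J co.

Lemma split_over_partial_sum A : submodule A -> partial_sum N co (A `&` N) ->
  split_over A (addm A N).
Proof.
move=> sA [_ _ psA] _ [a [u [Aa Nu ->]]].
(* [x] keeps the coordinates of [u] whose summands are not in A. Elements of A [&] N vanish at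
   these, so the projection onto [line x] kills A [&] N and extends to A + N by zero on A. *)
have [x Nx xE] := coords_component coP (fun i => ~~ `[< summand N co i `<=` A >]) Nu.
have Aux : A (u - x).
  apply: (coords_span sN coP) => // [|i]; first exact: submoduleB.
  rewrite (coordsB coP) // xE; case: asboolP => //= _; by rewrite subrr eqxx.
have [phi0 [l0 x0 L0 Z0]] := line_splitting M_tf sN coP R_pruefer R_hlocal Nx.
have phi0A y : A y -> N y -> phi0 y = 0.
  move=> Ay Ny; apply: Z0 => // i; rewrite xE.
  case: asboolP => [_|nS _]; first by rewrite eqxx.
  apply/eqP; rewrite -[_ == _]negbK; apply/negP => yi; apply: nS => z sz.
  by have [] : (A `&` N) z by exact: (psA y i).
have ex y : exists v, addm A N y -> N v /\ A (y - v).
  have [[a' [v [Aa' Nv ->]]]|nA] := pselect (addm A N y); last by exists 0.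
  by exists v; rewrite addrK.
have [v vP] := choice ex; pose phi y := phi0 (v y).
have phiE y w : addm A N y -> N w -> A (y - w) -> phi y = phi0 w.
  move=> ANy Nw Ayw; have [Nv Ayv] := vP _ ANy.
  apply/eqP; rewrite -subr_eq0 -(lin_onB sN l0) //; apply/eqP/phi0A; last exact: submoduleB.
  have -> : v y - w = (y - w) - (y - v y) by rewrite opprB [RHS]addrC addrA subrK.
  exact: submoduleB.
have NAN : N `<=` addm A N by exact: addm_subr.
exists x, phi; split.
- by rewrite -addrA; exact: submoduleD.
- move=> b y z ANy ANz; have [Ny Ay] := vP _ ANy; have [Nz Az] := vP _ ANz.
  rewrite (phiE (b *: y + z) (b *: v y + v z)).
  + by rewrite l0.
  + by apply: (submodule_addm sA sN).2.
  + exact: sN.2.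
  + by rewrite opprD addrACA -scalerBr; exact: sA.2.
- move=> y Ay; rewrite (phiE y 0) ?subr0 //.
  + by rewrite (lin_on0 sN l0).
  + exact: addm_subl.
  + exact: submodule0.
- by rewrite (phiE x x) ?subrr //; [exact: NAN|exact: submodule0].
- by move=> y /vP[Nv _]; exact: L0.
Qed.

End SplitOverPartialSum.

(** * Purity of A + N_n *)

Section PureSums.
Variables (R : idomainType) (M : lmodType R) (N : nat -> set M).
Hypotheses (sN : forall n, submodule (N n)) (pN : forall n, rd_pure (N n)).
Hypotheses (Ns : forall n, N n `<=` N n.+1) (NT : forall x, exists n, N n x).

(** Induction on k shows that (A [&] N_(n+k)) + N_n is pure, and every element of A lies in some
    N_(n+k). *)
Lemma rd_pure_addm A n : submodule A ->
  (forall k, rd_pure (addm (A `&` N k.+1) (N k))) -> rd_pure (addm A (N n)).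
Proof.
move=> sA pA.
have sAN k : submodule (A `&` N k) by exact: submoduleI.
have [Nm _] := total_on_nat Ns.
have step k : rd_pure (addm (A `&` N (n + k)%N) (N n)).
  elim: k => [|k IH].
    rewrite addn0 (_ : addm _ _ = N n) //; apply/seteqP; split; last exact: addm_subr.
    by apply: addm_sub => // x [].
  rewrite addnS => r x r0 [a [m [[Aa Na] Nnm e]]].
  have Nx : N (n + k).+1 x.
    apply: (pN r0); rewrite e; apply: submoduleD => //.
    by move: Nnm; apply: Nm; rewrite ltnW // ltnS leq_addr.
  have Nkm : N (n + k)%N m by move: Nnm; apply: Nm; rewrite leq_addr.
  (* The hypothesis at level n + k writes x = a' + m' with m' one level lower; r m' then differs
     from m by an element of A [&] N_(n+k), and induction decomposes m'. *)
  have [|a' [m' [[Aa' Na'] Nm' ex]]] := pA (n + k)%N r x r0.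
    by rewrite e; exists a, m; split.
  have rm : r *: m' = (a - r *: a') + m.
    by rewrite addrAC -e ex scalerDr addrC addKr.
  have Ak : (A `&` N (n + k)%N) (a - r *: a').
    split; first by apply: submoduleB => //; exact: submoduleZ.
    have -> : a - r *: a' = r *: m' - m by rewrite rm addrK.
    by apply: submoduleB => //; exact: submoduleZ.
  have [|b [w [[Ab Nb] Nw em]]] := IH r m' r0.
    by exists (a - r *: a'), m.
  exists (a' + b), w; split=> //; last by rewrite ex em addrA.
  split; first exact: submoduleD.
  by apply: submoduleD => //; exact: Ns.
move=> r x r0 [a [m [Aa Nm_ e]]]; have [k Nka] := NT a.
have [|a' [m' [[Aa' _] Nm' ex]]] := step k r x r0; last by exists a', m'.
exists a, m; split=> //; split=> //; move: Nka; apply: Nm; exact: leq_addl.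
Qed.

End PureSums.

(** * Pulling a G(aleph_0)-family of a quotient back to M *)

(** [G_family] speaks of well-ordered chains, [pure_family] of totally ordered sets of submodules; a
    cofinal well-ordered subchain has the same union. *)
Lemma wellordered_cofinal T (F : set (set T)) : total_on F subset ->
  exists (I : Type) (le : rel I) (D : I -> set T), [/\ well_order le,
    forall i, F (D i), forall i j, le i j -> D i `<=` D j &
    forall X, F X -> exists i, X `<=` D i].
Proof.
move=> Ft; have [W Wwo] := well_ordering_principle {classic (set T)}.
have Wc : wo_chain W predT by apply: withinW.
have Wanti (X Y : {classic (set T)}) : W X Y -> W Y X -> X = Y.
  by move=> XY YX; apply: (wo_chain_antisymmetric Wc) => //; rewrite XY YX.
(* [S] keeps the members that contain all members preceding them in the well-order [W]. The
   [W]-least member above a given X belongs to [S], whence cofinality. *)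
pose S : set {classic (set T)} := [set D | F D /\ forall X, F X -> W X D -> X `<=` D].
exists {D | S D}, (fun i j => W (sval i) (sval j)), (fun i => sval i); split.
- move=> A [i Ai].
  have [|z [[/asboolP[k Ak ek] zmin] _]] :=
      Wwo (fun X => `[< exists2 i, i \in A & sval i = X >]).
    by exists (sval i); apply/asboolP; exists i.
  exists k; split.
    by split=> // j Aj; rewrite ek; apply: zmin; apply/asboolP; exists j.
  move=> j [Aj jmin]; have jk := jmin _ Ak.
  have kj : W (sval k) (sval j) by rewrite ek; apply: zmin; apply/asboolP; exists j.
  by move: (Wanti _ _ kj jk); clear; case: k j => [X SX] [Y SY] /= e; exact: eq_exist.
- by move=> [D []].
- by move=> [D [FD DP]] [D' [FD' DP']] /= DD'; exact: DP'.
move=> X FX.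
have [|Y [[/asboolP[FY XY] Ymin] _]] :=
    Wwo (fun Y => `[< F Y /\ X `<=` Y >]); first by exists X; apply/asboolP; split.
have SY : S Y.
  split=> // Z FZ ZY; have [ZX|XZ] := Ft Z X FZ FX; first exact: subset_trans XY.
  rewrite (Wanti Z Y) //; apply: Ymin; exact/asboolP.
by exists (exist _ Y SY).
Qed.

(** Replaces the nested subtype and quotient by one map [p], meaningful only on A; elements outside
    A are treated as 0. *)
Lemma subquot_projection (R : pzRingType) (V : lmodType R) (A N : submodClosed V) :
  exists p : V -> subquot_mod A N, [/\
    (forall a x y, x \in A -> y \in A -> p (a *: x + y) = a *: p x + p y),
    (forall q, exists2 x, x \in A & p x = q) &
    (forall x, x \in A -> (p x = 0 <-> x \in N))].
Proof.
pose Z := zmod_of_submod (submod_in A N).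
pose pi (u : submod_mod A) : subquot_mod A N := \pi_(Quotient.quot Z)%qT u.
have piP a u v : pi (a *: u + v) = a *: pi u + pi v.
  by rewrite /pi raddfD; congr (_ + _); symmetry; exact: pi_scale.
have pi0 u : pi u = 0 <-> sval u \in N.
  have -> : 0 = pi 0 by rewrite /pi raddf0.
  split.
    by move=> /eqP; rewrite -Quotient.idealrBE subr0.
  by move=> uN; apply/eqP; rewrite -Quotient.idealrBE subr0.
pose ins (x : V) : submod_mod A := insubd (0 : submod_type A) x.
have insK x : x \in A -> sval (ins x) = x by move=> xA; exact: insubdK.
exists (fun x => pi (ins x)); split.
- move=> a x y xA yA; rewrite -piP; congr (pi _); apply: val_inj.
  by rewrite /= !insK // rpredD ?rpredZ.
- move=> q; exists (sval (repr (q : Quotient.quot Z))); first exact: valP.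
  rewrite -[RHS](@reprK _ (Quotient.quot Z)); congr (pi _); apply: val_inj.
  by rewrite /= insK //; exact: valP.
- by move=> x xA; rewrite pi0 insK.
Qed.

Section QuotientFamily.
Variables (R : idomainType) (M : lmodType R).
Variables (A N : submodClosed M) (NA : {subset N <= A}).
Hypotheses (pA : rd_pure [set` A]) (pN : rd_pure [set` N]).

(** The family consists of the preimages [pb c] of the members of [C]. *)
Lemma subquot_family (C : set (submodClosed (subquot_mod A N))) :
  G_family_pure C -> exists E, pure_family [set` N] [set` A] E.
Proof.
move=> [GC Cpure]; have [p [pl ps pk]] := subquot_projection A N.
have sA := submodule_submodClosed A; have sN := submodule_submodClosed N.
have peq x y : x \in A -> y \in A -> (p x = p y <-> x - y \in N).
  move=> xA yA; rewrite -pk ?rpredB //.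
    have -> : p (x - y) = p x - p y by rewrite addrC -scaleN1r pl // scaleN1r addrC.
    by split=> [->|/eqP]; rewrite ?subrr // subr_eq0 => /eqP.
  exact: (submoduleB sA).
pose pb (c : submodClosed (subquot_mod A N)) : set M := [set x | x \in A /\ p x \in c].
have spb c : submodule (pb c).
  split; first by split; [exact: rpred0|rewrite (pk 0 _).2 ?rpred0].
  move=> a x y [xA xc] [yA yc]; split; first exact: sA.2.
  by rewrite pl // rpredD ?rpredZ.
have Npb c : [set` N] `<=` pb c.
  by move=> x /= xN; split; [exact: NA|rewrite (pk x _).2 ?rpred0 //; exact: NA].
exists [set D | exists2 c, C c & D = pb c]; split.
- by move=> _ [c _ ->].
- move=> _ [c Cc ->] a x a0 [axA axc].
  have xA : x \in A by exact: (pA a0 axA).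
  split=> //.
  (* A single equation a q = p (a x) is solved in c; a lift y of q has a (x - y) in N, and purity of
     N gives p x = q. *)
  have [|q qc eq] := Cpure c Cc 1%N 1%N (const_mx a) (fun _ => p (a *: x)) (fun _ => axc).
    exists (fun _ => p x) => i; rewrite big_ord1 mxE.
    by rewrite -[a *: x]addr0 pl // ?rpred0 // (pk 0 _).2 ?rpred0 // addr0.
  have [y yA ey] := ps (q ord0).
  have -> : p x = p y; last by rewrite ey.
  apply/peq => //; apply: (pN a0) => /=; rewrite scalerBr.
  apply/peq; [exact: rpredZ|exact: rpredZ|].
  rewrite -(eq ord0) big_ord1 mxE -ey -[a *: y]addr0 pl // ?rpred0 //.
  by rewrite (pk 0 _).2 ?rpred0 // addr0.
- by move=> _ [c _ ->].
- by move=> _ [c _ ->] x [].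
- exists (zero_submod _); first exact: G_family0 GC.
  apply/seteqP; split=> [x xN|x [xA]]; first exact: Npb.
  by rewrite inE => /eqP; rewrite pk.
- move=> F F0 FE Ft; have [I [le [D [wo FD Dm Dc]]]] := wellordered_cofinal Ft.
  have exc i : exists c, C c /\ D i = pb c.
    by have [c Cc Dic] := FE _ (FD i); exists c.
  have [c cP] := choice exc.
  have sF : submodule (\bigcup_(D in F) D).
    by apply: submodule_bigcup => // X /FE[? _ ->].
  have FA X x : F X -> X x -> x \in A by move=> /FE[? _ ->] [].
  have sU : submodule [set q | exists2 x, (\bigcup_(D in F) D) x & p x = q].
    split; first by exists 0; [exact: submodule0|rewrite (pk 0 _).2 ?rpred0].
    move=> a _ _ [x Fx <-] [y Fy <-]; exists (a *: x + y); first exact: sF.2.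
    by case: Fx Fy => [X FX Xx] [Y FY Yy]; rewrite pl //; [exact: (FA X)|exact: (FA Y)].
  exists (submod_of sU); last first.
    apply/seteqP; split=> [x Fx|x [xA /submod_ofE[y [X FX Xy] /esym exy]]].
      split; first by case: Fx => X /FA; apply.
      by apply/submod_ofE; exists x.
    exists X => //; have yA := FA _ _ FX Xy.
    have := FX => /FE[c0 _ eX]; move: Xy; rewrite eX => -[_ yc]; split=> //.
    by rewrite exy.
  apply: (G_family_chain GC wo (A := c)); first by move=> i; case: (cP i).
    move=> i j lij q qc; have [x xA ex] := ps q.
    have : D j x by apply: (Dm i j lij); rewrite (cP i).2; split=> //; rewrite ex.
    by rewrite (cP j).2 => -[_]; rewrite ex.
  move=> q; split.
    move=> /submod_ofE[x [X FX Xx] <-]; have [i XD] := Dc X FX; exists i.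
    by have := XD _ Xx; rewrite (cP i).2 => -[].
  move=> [i qc]; have [x xA ex] := ps q; apply/submod_ofE; exists x => //.
  by exists (D i); [exact: FD|rewrite (cP i).2; split=> //; rewrite ex].
move=> _ G [c0 Cc0 ->] cG GA.
have [c1 [Cc1 c01 Hc1 [S [cS genS]]]] :=
  G_family_countable GC Cc0 (countable_image p cG).
have [p' [pl' ps' pk']] := subquot_projection c1 c0.
have exl z : exists x, pb c1 x /\ p' (p x) = z.
  have [q qc1 eq] := ps' z; have [x xA ex] := ps q.
  by exists x; split; [split=> //; rewrite ex|rewrite ex].
have [l lP] := choice exl.
exists (pb c1), (l @` S); split.
- by exists c1.
- by move=> x [xA /c01].
- by move=> g Gg; split; [exact: GA|apply: Hc1; exists g].
- exact: countable_image.
move=> B sB pB DB SB.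
(* The classes in c1 / c0 represented in B + N. They include the generators [S], hence are
   everything, so each x in the preimage of c1 differs from an element of B + N by one of the
   preimage of c0. *)
pose T : set (subquot_mod c1 c0) :=
  [set z | exists x, [/\ pb c1 x, addm B [set` N] x & p' (p x) = z]].
have sBN : submodule (addm B [set` N]) by exact: submodule_addm.
have p0 : p 0 = 0 by rewrite (pk 0 _).2 ?rpred0.
have sT : submodule T.
  split.
    exists 0; split; [exact: submodule0|exact: submodule0|].
    by rewrite p0 (pk' 0 _).2 ?rpred0.
  move=> a _ _ [x [xc xB <-]] [y [yc yB <-]]; exists (a *: x + y).
  split; [exact: (spb c1).2|exact: sBN.2|].
  by case: xc yc => [xA xc] [yA yc]; rewrite pl // pl'.
move=> x xc1.
have /submod_ofE[y [yc yB exy]] : p' (p x) \in submod_of sT.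
  apply: genS => z Sz; apply/submod_ofE; exists (l z); case: (lP z) => lc lz.
  by split=> //; apply: addm_subl => //; apply: SB; exists z.
have -> : x = (x - y) + y by rewrite subrK.
apply: submoduleD => //; apply: DB.
have [[xA xc] [yA pyc]] := (xc1, yc).
split; first exact: (submoduleB sA).
have exy' : p (x - y) = p x - p y by rewrite addrC -scaleN1r pl // scaleN1r addrC.
have xyc : p x - p y \in c1 by have := submoduleB (submodule_submodClosed c1) xc pyc.
rewrite exy'; apply/pk' => //.
have -> : p x - p y = -1 *: p y + p x by rewrite scaleN1r addrC.
by rewrite pl' // exy scaleN1r addNr.
Qed.

End QuotientFamily.

Lemma iso_dsum_coords (R : idomainType) (M : lmodType R) (N : submodClosed M) :
  iso_dsum_ideals (submod_mod N) ->
  exists (I : choiceType) (J : I -> ideal R) (co : M -> I -> R), coords [set` N] J co.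
Proof.
move=> [I [J [f [g fK gK]]]].
pose ins (x : M) : submod_mod N := insubd (0 : submod_type N) x.
have insK x : x \in N -> sval (ins x) = x by move=> xA; exact: insubdK.
have insS (u : submod_mod N) : ins (sval u) = u.
  by apply: val_inj; rewrite /= insK //; exact: valP.
exists {classic I}, J, (fun x i => sval (f (ins x)) i); split.
- move=> a x y i xN yN.
  have -> : ins (a *: x + y) = a *: ins x + ins y.
    by apply: val_inj; rewrite /= !insK // rpredD ?rpredZ.
  by rewrite linearP.
- by move=> x i _; have /asboolP[/(_ i)] := valP (f (ins x)).
- move=> x _; have /asboolP[_ /(@finite_seqP {classic I})[s es]] := valP (f (ins x)).
  exists s => i xi; have : [set i | sval (f (ins x)) i != 0] i by [].
  by rewrite es.
- move=> h s hJ hs.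
  have hd : (h : I -> R^o) \in mk_submod (dsum_closed J).
    apply/asboolP; split=> //; apply: sub_finite_set (finite_seq s) => i /= hi.
    exact: hs.
  pose hh : dsum_ideals J := exist (fun k => k \in mk_submod (dsum_closed J)) _ hd.
  exists (sval (g hh)); first exact: valP.
  by move=> i; rewrite insS gK.
- move=> x xN x0; rewrite -(insK x xN) -(fK (ins x)).
  have -> : f (ins x) = 0 by apply: val_inj; apply: funext => i; exact: x0.
  by rewrite -(linear0 f) fK.
Qed.

(** * Independent sets of lines *)

Section Independence.
Variables (R : idomainType) (M : lmodType R).
Implicit Types (X N : set M) (F : set (set M)).

Definition spn X : set M :=
  [set y | forall N, submodule N -> (forall x, X x -> line x `<=` N) -> N y].

(** The lines of the elements of X form a direct sum, each element standing for its line. *)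
Definition indep X := forall x y, X x -> line x y -> spn (X `\ x) y -> y = 0.

Lemma submodule_spn X : submodule (spn X).
Proof.
split=> [N sN _|a x y Sx Sy N sN XN]; first exact: submodule0.
by apply: sN.2; [exact: Sx|exact: Sy].
Qed.

Lemma spn_min X N : submodule N -> (forall x, X x -> line x `<=` N) -> spn X `<=` N.
Proof. by move=> sN XN y; apply. Qed.

Lemma spn_line X x : X x -> line x `<=` spn X.
Proof. by move=> Xx y xy N _ /(_ x Xx); apply. Qed.

Lemma spn_mono X X' : X `<=` X' -> spn X `<=` spn X'.
Proof.
move=> XX'; apply: spn_min; first exact: submodule_spn.
by move=> x /XX'; exact: spn_line.
Qed.

Lemma spn_setU1 X x : spn (x |` X) = addm (spn X) (line x).
Proof.
have sX := submodule_spn X; have sx := submodule_line x.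
apply/seteqP; split.
  apply: spn_min; first exact: submodule_addm.
  move=> z [->|Xz]; first exact: addm_subr.
  by apply: subset_trans (addm_subl sx); exact: spn_line.
apply: addm_sub; first exact: submodule_spn.
  by apply: spn_mono; right.
by apply: spn_line; left.
Qed.

(** The parameter [f] is the identity in the applications to spans and the removal of one element in
    [indep_bigcup]. *)
Lemma spn_bigcup F (f : set M -> set M) : F !=set0 -> total_on F subset ->
  (forall X Y, X `<=` Y -> f X `<=` f Y) ->
  spn (\bigcup_(X in F) f X) = \bigcup_(X in F) spn (f X).
Proof.
move=> [X0 FX0] Ft fm; apply/seteqP; split; last first.
  by move=> y [X FX]; apply: spn_mono => x fx; exists X.
have e : \bigcup_(X in F) spn (f X) = \bigcup_(N in (fun X => spn (f X)) @` F) N.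
  by rewrite bigcup_image.
apply: spn_min; rewrite ?e; last first.
  by move=> x [X FX fx]; rewrite -e => y xy; exists X => //; exact: spn_line xy.
apply: submodule_bigcup.
- by exists (spn (f X0)); exists X0.
- move=> _ _ [X FX <-] [Y FY <-].
  by have [XY|YX] := Ft X Y FX FY; [left|right]; apply: spn_mono; apply: fm.
- by move=> _ [X _ <-]; exact: submodule_spn.
Qed.

Lemma indep_setU1 X x : indep X -> (forall y, spn X y -> line x y -> y = 0) ->
  indep (x |` X).
Proof.
move=> iX xX z y zX zy; have [ezx|nzx] := pselect (z = x).
  rewrite ezx in zy *; move=> sy; apply: xX zy; move: sy.
  by apply: spn_mono => w [[->|//] nx]; case: nx.
case: zX => // Xz.
have -> : (x |` X) `\ z = x |` (X `\ z).
  apply/seteqP; split=> w; first by move=> [[->|Xw] wz]; [left|right].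
  by move=> [->|[Xw wz]]; [split; [left|exact/nesym]|split; [right|]].
rewrite spn_setU1 => -[u [v [su xv ey]]].
have v0 : v = 0.
  apply: (xX v) => //; have -> : v = y - u by rewrite ey addrC addKr.
  apply: (submoduleB (submodule_spn X)); first exact: (spn_line Xz).
  by move: su; apply: spn_mono => w [].
by apply: (iX z) => //; rewrite ey v0 addr0.
Qed.

Lemma indep_bigcup F : total_on F subset -> (forall X, F X -> indep X) ->
  indep (\bigcup_(X in F) X).
Proof.
move=> Ft Fi x y [X FX Xx] xy.
have -> : (\bigcup_(Y in F) Y) `\ x = \bigcup_(Y in F) (Y `\ x).
  apply/seteqP; split=> w; first by move=> [[Y FY Yw] wx]; exists Y.
  by move=> [Y FY [Yw wx]]; split=> //; exists Y.
rewrite (@spn_bigcup F (fun Y => Y `\ x)) //; last 2 first.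
- by exists X.
- by move=> Y Z YZ; exact: setSD.
move=> [Y FY sy]; have [XY|YX] := Ft X Y FX FY.
  by apply: (Fi Y FY x) => //; exact: XY.
by apply: (Fi X FX x) => //; move: sy; apply: spn_mono; exact: setSD.
Qed.

End Independence.

(** * From an independent spanning set to a direct sum of ideals *)

Section IndependentSum.
Variables (R : idomainType) (M : lmodType R).
Variables (X : set M) (Xi : indep X) (XT : forall y, spn X y).
Variable e : M -> M -> R.
Hypothesis e_lin : forall x a u v, line x u -> line x v ->
  e x (a *: u + v) = a * e x u + e x v.
Hypothesis e_inj : forall x u, line x u -> e x u = 0 -> u = 0.

Let e0 x : e x 0 = 0.
Proof.
have l0 := submodule0 (submodule_line x); apply: idempotent_add_eq0.
by have := e_lin 1 l0 l0; rewrite scale1r addr0 mul1r.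
Qed.

Lemma indep_projections : exists p : M -> M -> M, forall x, X x ->
  [/\ (forall a y z, p x (a *: y + z) = a *: p x y + p x z),
      (forall y, line x (p x y)), (forall y, line x y -> p x y = y) &
      (forall x' y, X x' -> x' <> x -> line x' y -> p x y = 0)].
Proof.
have ex x : exists px : M -> M, X x -> forall y, line x (px y) /\ spn (X `\ x) (y - px y).
  have [Xx|] := pselect (X x); last by exists id.
  suff exu y : exists u, line x u /\ spn (X `\ x) (y - u).
    by have [px pxP] := choice exu; exists px.
  have : spn (x |` (X `\ x)) y.
    apply: spn_mono (XT y) => z Xz.
    by have [->|zx] := pselect (z = x); [left|right].
  rewrite spn_setU1 => -[u [v [su xv ->]]]; exists v; split=> //.
  by rewrite addrK.
have [p pP] := choice ex; exists p => x Xx.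
have uniq_p y u : line x u -> spn (X `\ x) (y - u) -> p x y = u.
  move=> xu su; have [xp sp] := pP x Xx y.
  apply/eqP; rewrite -subr_eq0; apply/eqP/(Xi Xx).
    exact: (submoduleB (submodule_line x)).
  have -> : p x y - u = (y - u) - (y - p x y) by rewrite opprB [RHS]addrC addrA subrK.
  exact: (submoduleB (submodule_spn _)).
split.
- move=> a y z; have [xy sy] := pP x Xx y; have [xz sz] := pP x Xx z.
  apply: uniq_p; first exact: (submodule_line x).2.
  by rewrite opprD addrACA -scalerBr; apply: (submodule_spn _).2.
- by move=> y; case: (pP x Xx y).
- by move=> y xy; apply: uniq_p => //; rewrite subrr; exact: submodule0 (submodule_spn _).
- move=> x' y Xx' nx x'y; apply: uniq_p; first exact: submodule0 (submodule_line x).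
  by rewrite subr0; apply: spn_line x'y; split.
Qed.

Lemma indep_iso_dsum : iso_dsum_ideals M.
Proof.
have [p pP] := indep_projections.
have pD x y z : X x -> p x (y + z) = p x y + p x z.
  by move=> /pP[pl _ _ _]; rewrite -[y]scale1r pl !scale1r.
have p0 x : X x -> p x 0 = 0 by move=> /pP[_ _ + _]; apply; exact: submodule0 (submodule_line x).
(* Allowing every list that contains [s] makes the property stable under sums: two elements can be
   expanded over a common list. *)
have fsum y : exists s : seq M, [/\ uniq s, (forall x, x \in s -> X x) &
    forall s', uniq s' -> (forall x, x \in s' -> X x) -> {subset s <= s'} ->
      y = \sum_(x <- s') p x y].
  pose Q : set M := [set y | exists s : seq M, [/\ uniq s, (forall x, x \in s -> X x) &
    forall s', uniq s' -> (forall x, x \in s' -> X x) -> {subset s <= s'} ->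
      y = \sum_(x <- s') p x y]].
  suff QT : spn X `<=` Q by exact: QT.
  apply: spn_min.
    split.
      exists [::]; split=> // s _ sX _; rewrite big_seq big1 // => x /sX; exact: p0.
    move=> a u v [s [us sX sP]] [t [ut tX tP]].
    exists (undup (s ++ t)); split; first exact: undup_uniq.
      by move=> x; rewrite mem_undup mem_cat => /orP[/sX|/tX].
    move=> s' us' sX' ss'; rewrite {1}(sP s') //; last first.
      by move=> x xs; apply: ss'; rewrite mem_undup mem_cat xs.
    rewrite {1}(tP s') //; last first.
      by move=> x xs; apply: ss'; rewrite mem_undup mem_cat xs orbT.
    rewrite scaler_sumr -big_split /=; apply: eq_big_seq => x /sX' /pP[pl _ _ _].
    by rewrite pl.
  move=> x Xx u xu; exists [:: x]; split=> //.
    by move=> z; rewrite inE => /eqP ->.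
  move=> s us sX xs; have xs' : x \in s by apply: xs; exact: mem_head.
  have [_ _ px _] := pP x Xx.
  rewrite (bigD1_seq x) //= px // big_seq_cond big1 ?addr0 // => z /andP[/sX Xz zx].
  by have [_ _ _ pz] := pP z Xz; apply: (pz x) => //; apply/nesym/eqP.
(* The index type is all of [M]; outside [X] the ideal is zero, so no subtype of [M] is needed. *)
pose Phi y x : R := if `[< X x >] then e x (p x y) else 0.
pose Jset x : set R := [set r | exists2 u, line x u & r = if `[< X x >] then e x u else 0].
have iJ x : is_ideal (Jset x).
  split; first by exists 0; [exact: submodule0 (submodule_line x)|rewrite e0 if_same].
  move=> a _ _ [u xu ->] [v xv ->]; exists (a *: u + v).
    exact: (submodule_line x).2.
  by case: ifP => _; rewrite ?e_lin // [a *: _]mulr0 addr0.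
pose J (x : M) : ideal R := ideal_of (iJ x).
have PhiJ y : (Phi y : M -> R^o) \in mk_submod (dsum_closed J).
  apply/asboolP; split.
    move=> x; apply/ideal_ofE; have [Xx|nX] := pselect (X x).
      by exists (p x y) => //; have [_ + _ _] := pP x Xx; apply.
    exists 0; first exact: submodule0 (submodule_line x).
    by rewrite /Phi; case: asboolP.
  have [s [us sX sP]] := fsum y; apply: sub_finite_set (finite_seq s) => x /=.
  rewrite /Phi; case: asboolP => [Xx pxy|]; last by rewrite eqxx.
  apply: contrapT => /negP xs; move/eqP: pxy; apply.
  suff -> : p x y = 0 by [].
  (* Comparing the expansions of [y] over [s] and over [x :: s] shows that the projection at [x]
     vanishes. *)
  have := sP (x :: s); rewrite /= xs big_cons -(sP s) // => /(_ us) ey.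
  apply: (addIr y); rewrite add0r -ey //.
    by move=> z; rewrite in_cons => /orP[/eqP ->|/sX].
  by move=> z zs; rewrite in_cons zs orbT.
pose f y : dsum_ideals J := exist (fun k => k \in mk_submod (dsum_closed J)) _ (PhiJ y).
have f_lin : linear f.
  move=> a y z; apply: val_inj; apply: funext => x; rewrite /= /Phi.
  rewrite -[RHS]/(a * Phi y x + Phi z x) /Phi; case: asboolP => [Xx|_]; last by rewrite mulr0 addr0.
  by have [pl xp _ _] := pP x Xx; rewrite pl e_lin.
have f_inj : injective f.
  have ker y : f y = 0 -> y = 0.
    move=> fy; have [s [us sX sP]] := fsum y; rewrite (sP s) // big_seq big1 // => x /sX Xx.
    have [_ xp _ _] := pP x Xx; apply: e_inj (xp y) _.
    have /(congr1 (fun k : dsum_ideals J => sval k x)) := fy.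
    by rewrite /= /Phi; case: asboolP.
  move=> y z fyz; apply/eqP; rewrite -subr_eq0; apply/eqP/ker.
  by rewrite addrC -scaleN1r f_lin fyz scaleN1r addNr.
have f_surj k : exists y, f y = k.
  have /asboolP[kJ /finite_seqP[q eq]] := valP k.
  have exu x : exists u, line x u /\ sval k x = if `[< X x >] then e x u else 0.
    by have /ideal_ofE[u xu eu] := kJ x; exists u.
  have [u uP] := choice exu.
  pose s := [seq x <- undup q | `[< X x >]].
  have us : uniq s by rewrite filter_uniq // undup_uniq.
  have sX x : x \in s -> X x by rewrite mem_filter => /andP[/asboolP].
  exists (\sum_(x <- s) u x); apply: val_inj; apply: funext => x; rewrite /= /Phi.
  rewrite (uP x).2; case: asboolP => // Xx.
  rewrite (big_morph (p x) (fun y z => pD x y z Xx) (p0 x Xx)).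
  have [_ _ px px'] := pP x Xx.
  have other z : z \in s -> z != x -> p x (u z) = 0.
    by move=> /sX Xz /eqP zx; apply: (px' z) => //; case: (uP z).
  have [xs|xs] := boolP (x \in s).
    rewrite (bigD1_seq x) //= px; last by case: (uP x).
    by rewrite big_seq_cond big1 ?addr0 // => z /andP[]; exact: other.
  rewrite big_seq big1 => [|z zs]; last first.
    by apply: other => //; apply: contraNneq xs => <-.
  rewrite e0; have := (uP x).2; rewrite (asboolT Xx) => <-.
  apply/esym/eqP; rewrite -[_ == _]negbK; apply/negP => kx.
  move/negP: xs; apply; rewrite mem_filter asboolT //= mem_undup.
  by have : [set i | sval k i != 0] x by []; rewrite eq.
have [g gP] := choice f_surj.
exists M, J, (mk_linear f_lin); exists g => // y; apply: f_inj; exact: gP.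
Qed.

End IndependentSum.

(** * Assembling a decomposition of M by Zorn's lemma *)

Section Main.
Variables (R : idomainType) (R_pruefer : pruefer R) (R_hlocal : h_local R).
Variables (M : lmodType R) (M_tf : torsion_free M) (N : nat -> submodClosed M).
Hypothesis N_ascending : forall n, {subset N n <= N n.+1}.
Hypothesis N_union : forall x, exists n, x \in N n.
Hypothesis N_dsum : forall n, iso_dsum_ideals (submod_mod (N n)).
Hypothesis N_G_family : forall n,
  exists C : set (submodClosed (subquot_mod (N n.+1) (N n))), G_family_pure C.
Hypothesis N_pure : forall n, pure (N n).

Let NN n : set M := [set` N n].
Let sN n : submodule (NN n). Proof. exact: submodule_submodClosed. Qed.
Let pN n : rd_pure (NN n). Proof. exact: pure_rd_pure. Qed.
Let Ns n : NN n `<=` NN n.+1. Proof. exact: N_ascending. Qed.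

(** A coordinate at which [x] is nonzero is injective on the rank-one module [line x] and identifies
    it with an ideal. *)
Lemma line_functional x : exists e : M -> R,
  (forall a u v, line x u -> line x v -> e (a *: u + v) = a * e u + e v) /\
  (forall u, line x u -> e u = 0 -> u = 0).
Proof.
have [x0|nx0] := pselect (x = 0).
  exists (fun=> 0); split=> [a u v _ _|u [a [b [a0 eu]]] _]; first by rewrite mulr0 addr0.
  by move: eu; rewrite x0 scaler0 => /(tf0 M_tf a0).
have [n Nx] := N_union x; have [I [J [co coP]]] := iso_dsum_coords (N_dsum n).
have [i xi] : exists i, co x i != 0.
  apply: contrapT => ni; apply: nx0; apply: (coords_inj coP) => // i.
  by apply/eqP; rewrite -[_ == _]negbK; apply/negP => xi; apply: ni; exists i.
have lN : line x `<=` NN n by exact: line_min.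
exists (fun y => co y i); split=> [a u v /lN Nu /lN Nv|u xu ui].
  exact: (coords_lin coP).
have Nu := lN _ xu; case: xu => a [b [a0 e]]; apply: (tf0 M_tf a0).
have := coordsZ (sN n) coP b i Nx; rewrite -e (coordsZ (sN n) coP) // ui mulr0 => /esym/eqP.
by rewrite mulf_eq0 (negPf xi) orbF e => /eqP ->; rewrite scale0r.
Qed.

(** The left copy of [nat] asks that A [&] N_n be a partial sum, which feeds
    [split_over_partial_sum]. The right copy asks that the image of A in N_(n+1) / N_n belong to the
    given family, which feeds [rd_pure_addm]. *)
Lemma exists_good_families : exists (K : countType) (L U : K -> set M)
  (E : K -> set (set M)), [/\ forall k, submodule (L k), forall k, submodule (U k),
    forall k, pure_family (L k) (U k) (E k) &
    forall A, good L U E A -> forall n,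
      rd_pure (addm A (NN n)) /\ split_over A (addm A (NN n))].
Proof.
have exP n : exists E : set (set M), pure_family [set 0] (NN n) E /\
    forall A, submodule A -> E (A `&` NN n) -> split_over A (addm A (NN n)).
  have [I [J [co coP]]] := iso_dsum_coords (N_dsum n).
  exists (partial_sum (NN n) co); split; first exact: (partial_sum_family (sN n) (@pN n) coP).
  by move=> A sA; exact: (split_over_partial_sum M_tf R_pruefer R_hlocal (sN n) coP).
have [P PP] := choice exP.
have exQ n : exists E : set (set M), pure_family (NN n) (NN n.+1) E.
  have [C CP] := N_G_family n.
  exact: (subquot_family (@N_ascending n) (@pN n.+1) (@pN n) CP).
have [Q QP] := choice exQ.
exists (nat + nat)%type, (fun k => match k with inl _ => [set 0] | inr n => NN n end),
  (fun k => match k with inl n => NN n | inr n => NN n.+1 end),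
  (fun k => match k with inl n => P n | inr n => Q n end); split.
- by case=> n //; exact: submodule_set0.
- by case.
- by case=> n //; exact: (PP n).1.
move=> A [sA pA EA] n; split.
  apply: rd_pure_addm => // k.
  exact: (family_pure (QP k) (EA (inr k))).
apply: (PP n).2 => //; have := EA (inl n); rewrite (_ : addm _ _ = A `&` NN n) //.
apply/seteqP; split; last exact/addm_subl/submodule_set0.
have sAN : submodule (A `&` NN n) by exact: submoduleI.
by apply: addm_sub => // _ /= ->; exact: (submodule0 sAN).
Qed.

Lemma exists_common_index (h : nat -> M) k :
  exists n, forall j, (j < k)%N -> NN n (h j).
Proof.
have [Nm _] := total_on_nat Ns.
elim: k => [|k [n nP]]; first by exists 0%N.
have [n' n'P] := N_union (h k); exists (maxn n n') => j; rewrite ltnS leq_eqVlt.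
move=> /orP[/eqP ->|/nP]; first by move: n'P; apply: Nm; exact: leq_maxr.
by apply: Nm; exact: leq_maxl.
Qed.

(** Zorn's lemma is applied to independent sets with good span. If the span missed [x], a good
    extension containing [x] would be reached by rank-one steps, each adding one line. *)
Lemma exists_indep_span : exists X : set M, indep X /\ forall y, spn X y.
Proof.
have [K [L [U [E [sL sU EP goodP]]]]] := exists_good_families.
have [F FQ Ft|X [[iX gX] Xmax]] :=
    @Zorn_bigcup M [set X | indep X /\ good L U E (spn X)].
  split; first by apply: indep_bigcup => // X /FQ[].
  have [[X0 FX0]|nF] := pselect (F !=set0).
    rewrite (@spn_bigcup _ _ F id) //; last by exists X0.
    rewrite (_ : \bigcup_(X in F) _ = \bigcup_(A in @spn R M @` F) A); last by rewrite bigcup_image.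
    apply: (good_bigcup EP).
    - by exists (spn X0); exists X0.
    - by move=> _ [X /FQ[_ gX] <-].
    - move=> _ _ [X FX <-] [Y FY <-].
      by have [XY|YX] := Ft X Y FX FY; [left|right]; exact: spn_mono.
  (* The empty chain, whose union has span 0. *)
  rewrite (_ : spn _ = [set 0]); first exact: (good0 sU EP).
  apply/seteqP; split; last by move=> _ /= ->; exact: submodule0 (submodule_spn _).
  apply: spn_min; first exact: submodule_set0.
  by move=> x [X FX]; case: nF; exists X.
exists X; split=> // x; apply: contrapT => nx.
pose A := spn X; have [sA pA _] := gX.
have [h [gB Bx]] := good_extend sL sU EP x gX.
have sAN n : submodule (addm A (NN n)) by exact: submodule_addm.
(* For finitely many steps one A + N_n contains all the [h j] used, so the splitting property over A
   passes along the steps inside this fixed module. The index [n] may grow with [k]. *)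
have Ah k n : (forall j, (j < k)%N -> NN n (h j)) ->
    exts A h k `<=` addm A (NN n) /\ split_over (exts A h k) (addm A (NN n)).
  have [pAN spl] := goodP A gX n.
  elim: k => [|k IH] hN; first by split=> //; exact: addm_subl.
  have [|EN Espl] := IH; first by move=> j jk; apply: hN; rewrite ltnW.
  have Nh : addm A (NN n) (h k) by apply: addm_subr => //; exact: hN.
  split; first by apply: ext_min.
  by apply: split_over_ext => //; [exact: submodule_exts|exact: rd_pure_exts].
have exx k : exists z, exts A h k.+1 = addm (exts A h k) (line z) /\
    forall y, exts A h k y -> line z y -> y = 0.
  have [n hN] := exists_common_index h k.+1.
  have [|EN Espl] := Ah k n; first by move=> j jk; apply: hN; rewrite ltnW.
  have [pAN _] := goodP A gX n.
  have Nh : addm A (NN n) (h k) by apply: addm_subr => //; exact: hN.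
  have [||z [ez dz]] := split_over_decomp M_tf _ _ (sAN n) pAN EN Nh Espl; last by exists z.
    exact: submodule_exts.
  exact: rd_pure_exts.
have [z zP] := choice exx.
pose Xk := fix Xk k := if k is k'.+1 then z k' |` Xk k' else X.
have XkP k : indep (Xk k) /\ spn (Xk k) = exts A h k.
  elim: k => //= k [ik ek]; have [ez dz] := zP k; split.
    by apply: indep_setU1 => // y; rewrite ek; exact: dz.
  by rewrite spn_setU1 ek -ez.
have Xks k : Xk k `<=` Xk k.+1 by right.
have [Xkm tot] := total_on_nat Xks.
pose X' := \bigcup_(Y in range Xk) Y.
have iX' : indep X' by apply: indep_bigcup => // _ [k _ <-]; case: (XkP k).
have sX' : spn X' = cl A (range h).
  rewrite (@spn_bigcup _ _ (range Xk) id) //; last by exists X; exists 0%N.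
  by rewrite bigcup_image cl_exts //; apply: eq_bigcupr => k _; case: (XkP k).
have XX' : X `<=` X' by move=> y Xy; exists X => //; exists 0%N.
(* Either [X'] adds nothing and [x] is already in the span of [X], or [X'] contradicts
   maximality. *)
have [X'X|nX'X] := pselect (X' `<=` X).
  by apply: nx; apply: (spn_mono X'X); rewrite sX'.
by apply: (Xmax X') => //; split=> //; rewrite sX'.
Qed.

Lemma union_iso_dsum : iso_dsum_ideals M.
Proof.
have [X [iX XT]] := exists_indep_span; have [e eP] := choice line_functional.
by apply: (indep_iso_dsum iX XT (e := e)) => x; case: (eP x).
Qed.

End Main.

Theorem theorem10 (R : idomainType) (R_pruefer : pruefer R) (R_hlocal : h_local R)
    (M : lmodType R) (M_tf : torsion_free M)
    (M_ : nat -> submodClosed M)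
    (M_zero : M_ 0%N = zero_submod M)
    (M_ascending : forall n : nat, {subset M_ n <= M_ n.+1})
    (M_union : forall x : M, exists n : nat, x \in M_ n)
    (M_dsum : forall n : nat, iso_dsum_ideals (submod_mod (M_ n)))
    (M_G_family : forall n : nat,
       exists C : set (submodClosed (subquot_mod (M_ n.+1) (M_ n))),
         G_family_pure C)
    (M_pure : forall n : nat, pure (M_ n)) :
  iso_dsum_ideals M.
Proof.
exact: (union_iso_dsum R_pruefer R_hlocal M_tf M_ascending M_union M_dsum
  M_G_family M_pure).
Qed.
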